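(* Let $n\ge1$. The mapping $t\in GL(n,\mathbb{C})\mapsto e_t\in\mathcal{G}(U(n))$ is a bijection. Moreover, for $t\in GL(n,\mathbb{C})$, $e_t\in\mathcal{E}(U(n))$ if and only if $t\in GL(n,\mathbb{C})_+:=GL(n,\mathbb{C})\cap\mathbb{M}_n(\mathbb{C})_+$.
   Context: $\mathbb{C}[U(n)]\subset C(U(n))$ is the algebra spanned by the matrix coefficients $c^\pi_{\xi,\eta}(u)=\langle\pi(u)\xi,\eta\rangle$ of finite-dimensional unitary representations $(\pi,\mathcal{H})$ of the unitary group $U(n)$; $\mathcal{U}(U(n))=\mathbb{C}[U(n)]^*$ is its algebraic dual, with pairing $(\cdot,\cdot)$, and $\mathcal{U}(U(n)^2)=(\mathbb{C}[U(n)]\otimes\mathbb{C}[U(n)])^*$. Each finite-dimensional unitary representation extends to $\pi:\mathcal{U}(U(n))\to B(\mathcal{H})$ by $\langle\pi(x)\xi,\eta\rangle=(x,c^\pi_{\xi,\eta})$. An element $x\in\mathcal{U}(U(n))$ is positive if $\pi(x)$ is positive semi-definite for every finite-dimensional unitary representation $\pi$; $\mathcal{U}(U(n))_+$ is the set of positive elements. Define $\hat\Delta:\mathcal{U}(U(n))\to\mathcal{U}(U(n)^2)$ by $(\hat\Delta(x),f\otimes g)=(x,fg)$. A nonzero $e\in\mathcal{U}(U(n))$ is group-like if $\hat\Delta(e)=e\otimes e$; $\mathcal{G}(U(n))$ is the set of group-like elements, and $\mathcal{E}(U(n))=\mathcal{G}(U(n))\cap\mathcal{U}(U(n))_+$.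 By Weyl's unitary trick every finite-dimensional representation of $U(n)$ extends uniquely to a holomorphic representation of $GL(n,\mathbb{C})$, so every $f\in\mathbb{C}[U(n)]$ extends to a function on $GL(n,\mathbb{C})$ (the extension of $c^\pi_{\xi,\eta}$ being $t\mapsto\langle\pi(t)\xi,\eta\rangle$). For $t\in GL(n,\mathbb{C})$, $e_t\in\mathcal{U}(U(n))$ is the evaluation $(e_t,f)=f(t)$; it is group-like. $\mathbb{M}_n(\mathbb{C})_+$ is the set of positive semi-definite $n\times n$ matrices. *)

(* Defs.v *)
From HB Require Import structures.
From mathcomp Require Import all_boot all_order all_algebra.
From mathcomp Require Import spectral sesquilinear complex mxtens.
From mathcomp Require Import all_classical all_reals all_analysis.

Set Implicit Arguments.
Unset Strict Implicit.
Unset Printing Implicit Defensive.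

Import Order.TTheory GRing.Theory Num.Theory.
Import numFieldNormedType.Exports.
Local Open Scope classical_set_scope.
Local Open Scope ring_scope.

(* Everything is written over an abstract numClosedFieldType C, which carries
   the norm topology used below; the theorem takes C := R[i]. *)

Lemma cvg_mx (C : numFieldType) (T : Type) (F : set_system T) (FF : Filter F)
    d e (f : T -> 'M[C]_(d, e)) (l : 'M[C]_(d, e)) :
  (forall i j, (fun x => f x i j) @ F --> l i j) -> f @ F --> l.
Proof.
move=> fl; apply/cvg_ballP => r r0; near=> x; split=> //.
near: x; apply: filter_forall => i; apply: filter_forall => j.
by have /cvg_ballP := fl i j; exact.
Unshelve. all: by end_near. Qed.

Section LinearSpan.
Context {C : numClosedFieldType} {V : lmodType C}.

Definition lin_span (S : set V) : set V := [set v |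
  exists (k : nat) (a : 'I_k -> C) (g : 'I_k -> V),
    (forall i, S (g i)) /\ v = \sum_i a i *: g i].

Lemma lin_span_gen S v : S v -> lin_span S v.
Proof.
by move=> Sv; exists 1%N, (fun=> 1), (fun=> v); rewrite big_ord1 scale1r.
Qed.

Lemma lin_span0 S : lin_span S 0.
Proof. by exists 0%N, (fun=> 0), (fun=> 0); rewrite big_ord0; split=> // -[]. Qed.

Lemma lin_spanZ S a v : lin_span S v -> lin_span S (a *: v).
Proof.
move=> [k [b [g [Sg ->]]]]; exists k, (fun i => a * b i), g; split=> //.
by rewrite scaler_sumr; apply: eq_bigr => i _; rewrite scalerA.
Qed.

Lemma lin_spanD S v w : lin_span S v -> lin_span S w -> lin_span S (v + w).
Proof.
move=> [k [a [g [Sg ->]]]] [l [b [h [Sh ->]]]]; exists (k + l)%N,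
  (fun i => match fintype.split i with inl j => a j | inr j => b j end),
  (fun i => match fintype.split i with inl j => g j | inr j => h j end); split.
  by move=> i; case: (fintype.split i).
rewrite big_split_ord; congr (_ + _); apply: eq_bigr => i _.
  by have := unsplitK (inl i : 'I_k + 'I_l); rewrite /= => ->.
by have := unsplitK (inr i : 'I_k + 'I_l); rewrite /= => ->.
Qed.

Lemma lin_span_sum S k (v : 'I_k -> V) :
  (forall i, lin_span S (v i)) -> lin_span S (\sum_i v i).
Proof.
move=> Sv; elim/big_ind: _ => [|u w|i _]; [exact: lin_span0|exact: lin_spanD|exact: Sv].
Qed.

Lemma lin_span_submod S : submod_closed [pred v | `[< lin_span S v >]].
Proof.
split=> [|a u v /asboolP Su /asboolP Sv]; apply/asboolP; first exact: lin_span0.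
by apply: lin_spanD => //; exact: lin_spanZ.
Qed.

End LinearSpan.

Section Hermitian.
Context {C : numClosedFieldType}.

(* The inner product of C^d, linear in the first variable. *)
Definition dotc d (xi eta : 'cV[C]_d) : C := \sum_i xi i ord0 * (eta i ord0)^*.

Definition psdmx d (M : 'M[C]_d) : Prop :=
  M \is hermsymmx /\ forall xi : 'cV[C]_d, 0 <= dotc (M *m xi) xi.

End Hermitian.

Section Representations.
Context (C : numClosedFieldType) (n : nat).

Definition unitary_group : Type := {u : 'M[C]_n | u \is unitarymx}.
Definition general_linear : Type := {t : 'M[C]_n | t \in unitmx}.

(* A finite-dimensional unitary representation of U(n), in an orthonormal
   basis of its Hilbert space. Representations of a topological group are
   continuous. The values of uact outside U(n) are irrelevant. *)
Record unitary_rep := UnitaryRep {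
  udim : nat;
  uact :> 'M[C]_n -> 'M[C]_udim;
  uact1 : uact 1%:M = 1%:M;
  uactM : forall u v, u \is unitarymx -> v \is unitarymx ->
    uact (u *m v) = uact u *m uact v;
  uact_unitary : forall u, u \is unitarymx -> uact u \is unitarymx;
  uact_continuous : {within [set u | u \is unitarymx], continuous uact} }.

Definition matrix_coef (p : unitary_rep) (xi eta : 'cV[C]_(udim p)) :
  unitary_group -> C := fun u => dotc (p (val u) *m xi) eta.

(* P is the action of a holomorphic representation of GL(n, C) extending p;
   since GL(n, C) is open in the normed C-space of all matrices, holomorphic
   means (C-)differentiable at every invertible matrix. *)
Definition holomorphic_ext (p : unitary_rep) (P : 'M[C]_n -> 'M[C]_(udim p)) :=
  [/\ P 1%:M = 1%:M,
      forall s t, s \in unitmx -> t \in unitmx -> P (s *m t) = P s *m P t,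
      forall t : 'M[C]_n, t \in unitmx -> differentiable P t
    & forall u, u \is unitarymx -> P u = p u].

Definition GL_coef d (P : 'M[C]_n -> 'M[C]_d) (xi eta : 'cV[C]_d) :
  general_linear -> C := fun t => dotc (P (val t) *m xi) eta.

End Representations.

Section CoefficientAlgebra.
Context (C : numClosedFieldType) (n : nat).
Local Notation U := (unitary_group C n).

Definition coef_span : set (U -> C) :=
  lin_span [set f | exists p xi eta, f = @matrix_coef C n p xi eta].

Definition coef_pred : {pred U -> C} := [pred f | `[< coef_span f >]].

Lemma coef_pred_submod : submod_closed coef_pred.
Proof. exact: lin_span_submod. Qed.

HB.instance Definition _ :=
  GRing.isSubmodClosed.Build C (U -> C) coef_pred coef_pred_submod.

Definition one_rep_act (u : 'M[C]_n) : 'M[C]_1 := 1%:M.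

Lemma cst_rep_continuous : {within [set u | u \is unitarymx], continuous one_rep_act}.
Proof. exact: cst_continuous. Qed.

Lemma unitarymx1 d : (1%:M : 'M[C]_d) \is unitarymx.
Proof. by apply/unitarymxP; rewrite trmx1 map_mx1 mulmx1. Qed.

Definition one_rep : unitary_rep C n := @UnitaryRep C n 1 one_rep_act
  erefl (fun _ _ _ _ => esym (mulmx1 _)) (fun _ _ => unitarymx1 1)
  cst_rep_continuous.

Definition tens_act (p q : unitary_rep C n) (u : 'M[C]_n) :
  'M[C]_(udim p * udim q) := tensmx (p u) (q u).

Lemma tens_act1 p q : tens_act p q 1%:M = 1%:M.
Proof.
rewrite /tens_act !uact1; apply/matrixP => i j; rewrite !mxE.
case: (mxtens_indexP i) => i1 i2; case: (mxtens_indexP j) => j1 j2.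
rewrite !mxtens_indexK /= -natrM mulnb.
by rewrite (can_eq (@mxtens_indexK _ _)) -pair_eqE.
Qed.

Lemma tens_actM p q u v : u \is unitarymx -> v \is unitarymx ->
  tens_act p q (u *m v) = tens_act p q u *m tens_act p q v.
Proof. by move=> hu hv; rewrite /tens_act tensmx_mul !uactM. Qed.

Lemma tens_unitary d e (A : 'M[C]_d) (B : 'M[C]_e) :
  A \is unitarymx -> B \is unitarymx -> tensmx A B \is unitarymx.
Proof.
move=> /unitarymxP hA /unitarymxP hB; apply/unitarymxP.
rewrite trmx_tens map_mxT tensmx_mul hA hB; apply/matrixP => i j; rewrite !mxE.
case: (mxtens_indexP i) => i1 i2; case: (mxtens_indexP j) => j1 j2.
rewrite !mxtens_indexK /= -natrM mulnb.
by rewrite (can_eq (@mxtens_indexK _ _)) -pair_eqE.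
Qed.

Lemma tens_act_continuous p q :
  {within [set u | u \is unitarymx], continuous (tens_act p q)}.
Proof.
have c (r : unitary_rep C n) i j :
    {within [set u | u \is unitarymx], continuous (fun u => r u i j)}.
  move=> x; apply: (@cvg_comp _ _ _ r (fun M => M i j) _ (nbhs (r x))).
    exact: uact_continuous.
  exact: coord_continuous.
move=> x; apply: cvg_mx => i j.
have -> : (fun u => tens_act p q u i j) = (fun u =>
    p u (mxtens_unindex i).1 (mxtens_unindex j).1 *
    q u (mxtens_unindex i).2 (mxtens_unindex j).2).
  by apply/funext => u; rewrite mxE.
by rewrite mxE; apply: cvgM; exact: c.
Qed.

Definition tens_rep (p q : unitary_rep C n) : unitary_rep C n :=
  @UnitaryRep C n _ (tens_act p q) (tens_act1 p q) (@tens_actM p q)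
  (fun u hu => tens_unitary (uact_unitary p hu) (uact_unitary q hu))
  (@tens_act_continuous p q).

Lemma matrix_coef_tens p q xi eta xi' eta' :
  @matrix_coef C n p xi eta * @matrix_coef C n q xi' eta' =
  @matrix_coef C n (tens_rep p q)
    (\col_k (xi (mxtens_unindex k).1 ord0 * xi' (mxtens_unindex k).2 ord0))
    (\col_k (eta (mxtens_unindex k).1 ord0 * eta' (mxtens_unindex k).2 ord0)).
Proof.
apply/funext => u; rewrite mulrfctE /matrix_coef /dotc mulr_sum /=.
apply: eq_bigr => i _; rewrite !mxE mulrACA -rmorphM; congr (_ * _).
by rewrite mulr_sum; apply: eq_bigr => j _; rewrite !mxE mulrACA.
Qed.

Lemma matrix_coef_one :
  1 = @matrix_coef C n one_rep (const_mx 1) (const_mx 1).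
Proof.
by apply/funext => u; rewrite /matrix_coef /dotc big_ord1 mul1mx !mxE conjC1 mulr1.
Qed.

Lemma coef_pred_mulr : GRing.mulr_closed coef_pred.
Proof.
split=> [|f g /asboolP[k [a [f' [Sf ->]]]] /asboolP[l [b [g' [Sg ->]]]]]; apply/asboolP.
  by apply: lin_span_gen; do 3 eexists; exact: matrix_coef_one.
rewrite mulr_suml; apply: lin_span_sum => i; rewrite mulr_sumr.
apply: lin_span_sum => j; have -> : a i *: f' i * (b j *: g' j) = (a i * b j) *: (f' i * g' j).
  by apply/funext => u; rewrite !fctE mulrACA.
apply: lin_spanZ; apply: lin_span_gen.
have [p [xi [eta ->]]] := Sf i; have [q [xi' [eta' ->]]] := Sg j.
by do 3 eexists; exact: matrix_coef_tens.
Qed.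

HB.instance Definition _ :=
  GRing.isMulClosed.Build (U -> C) coef_pred coef_pred_mulr.

(* C[U(n)], with the ring and C-module structures of functions on U(n). *)
Record coef_alg := CoefAlg {
  coef_fun :> U -> C;
  _ : coef_fun \in coef_pred }.

HB.instance Definition _ := [isSub for coef_fun].
HB.instance Definition _ := [Choice of coef_alg by <:].
HB.instance Definition _ := 
  GRing.SubChoice_isSubComPzRing.Build _ _ coef_alg (subringClosedP _).
HB.instance Definition _ := 
  [SubZmodule_isSubLmodule of coef_alg by <:].

End CoefficientAlgebra.

Section TensorSquare.
Context (C : numClosedFieldType) (n : nat).
Local Notation U := (unitary_group C n).
Local Notation A := (coef_alg C n).

(* The tensor product C[U(n)] (x) C[U(n)], realised as the functions on
   U(n) x U(n) spanned by the f (x) g : (u, v) |-> f u * g v. Lemma tens_liftE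
   and tens_dual_ext below are its universal property. *)
Definition tens_span : set (U * U -> C) :=
  lin_span [set h | exists f g : A, h = fun uv => f uv.1 * g uv.2].

Definition tens_pred : {pred U * U -> C} := [pred h | `[< tens_span h >]].

Lemma tens_pred_submod : submod_closed tens_pred.
Proof. exact: lin_span_submod. Qed.

HB.instance Definition _ :=
  GRing.isSubmodClosed.Build C (U * U -> C) tens_pred tens_pred_submod.

Record tens_alg := TensAlg {
  tens_fun :> U * U -> C;
  _ : tens_fun \in tens_pred }.

HB.instance Definition _ := [isSub for tens_fun].
HB.instance Definition _ := [Choice of tens_alg by <:].
HB.instance Definition _ := [SubChoice_isSubZmodule of tens_alg by <:].
HB.instance Definition _ := [SubZmodule_isSubLmodule of tens_alg by <:].

Lemma tens_elt_subproof (f g : A) :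
  (fun uv : U * U => f uv.1 * g uv.2) \in tens_pred.
Proof. by apply/asboolP/lin_span_gen; exists f, g. Qed.

Definition tens_elt (f g : A) : tens_alg := TensAlg (tens_elt_subproof f g).

Lemma coef_funZ (a : C) (f : A) u : (a *: f : A) u = a * f u.
Proof. by []. Qed.

Lemma coef_funN (f : A) u : (- f : A) u = - f u.
Proof. by []. Qed.

Lemma coef_funD (f g : A) u : (f + g : A) u = f u + g u.
Proof. by []. Qed.

Lemma coef_fun_sum (I : Type) (r : seq I) (F : I -> A) u :
  (\sum_(i <- r) F i : A) u = \sum_(i <- r) F i u.
Proof.
by elim: r => [|i r ih]; rewrite ?big_nil // !big_cons -ih.
Qed.

Lemma tens_fun_sum (I : Type) (r : seq I) (F : I -> tens_alg) u :
  (\sum_(i <- r) F i : tens_alg) u = \sum_(i <- r) F i u.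
Proof.
by elim: r => [|i r ih]; rewrite ?big_nil // !big_cons -ih.
Qed.

Lemma tens_decomp (h : tens_alg) :
  exists s : seq (A * A), h = \sum_(p <- s) tens_elt p.1 p.2.
Proof.
have /asboolP[k [a [g [Sg hE]]]] := valP h.
have /choice[F FE] i : exists p : A * A, g i = fun uv => p.1 uv.1 * p.2 uv.2.
  by have [f1 [f2 ->]] := Sg i; exists (f1, f2).
exists [seq (a i *: (F i).1, (F i).2) | i <- index_enum 'I_k].
apply/val_inj/funext => u; rewrite /= tens_fun_sum big_map [LHS](congr1 (@^~ u) hE).
by rewrite fct_sumE; apply: eq_bigr => i _; rewrite scalrfctE FE /= -mulrA.
Qed.

Definition bilin (B : A -> A -> C) : Prop :=
  (forall g, scalar (B^~ g)) /\ (forall f, scalar (B f)).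

Section Bilin.
Context (B : A -> A -> C) (hB : bilin B).

Lemma bilinDl f f' g : B (f + f') g = B f g + B f' g.
Proof. by have := hB.1 g 1 f f'; rewrite scale1r mul1r. Qed.

Lemma bilin0l g : B 0 g = 0.
Proof. by apply: (addrI (B 0 g)); rewrite -bilinDl !addr0. Qed.

Lemma bilinZl a f g : B (a *: f) g = a * B f g.
Proof. by have := hB.1 g a f 0; rewrite bilin0l !addr0. Qed.

Lemma bilinDr f g g' : B f (g + g') = B f g + B f g'.
Proof. by have := hB.2 f 1 g g'; rewrite scale1r mul1r. Qed.

Lemma bilin0r f : B f 0 = 0.
Proof. by apply: (addrI (B f 0)); rewrite -bilinDr !addr0. Qed.

Lemma bilinZr a f g : B f (a *: g) = a * B f g.
Proof. by have := hB.2 f a g 0; rewrite bilin0r !addr0. Qed.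

Lemma bilin_sumr I (r : seq I) f (F : I -> A) :
  B f (\sum_(i <- r) F i) = \sum_(i <- r) B f (F i).
Proof.
by elim: r => [|i r ih]; rewrite ?big_nil ?bilin0r // !big_cons bilinDr ih.
Qed.

Lemma tens_rel (s : seq (A * A)) :
  (forall u v, \sum_(p <- s) p.1 u * p.2 v = 0) ->
  \sum_(p <- s) B p.1 p.2 = 0.
Proof.
have [k] := ubnP (size s); elim: k s => // k ih [|[f g] s] /= sk s0.
  by rewrite big_nil.
have [f0|[u0 fu0]] : f = 0 \/ exists u0, f u0 != 0.
- have [|/existsNP[u /eqP]] := pselect (forall u, f u = 0); last by right; exists u.
  by left; apply/val_inj/funext.
- rewrite big_cons f0 bilin0l add0r; apply: ih => // u v.
  by have := s0 u v; rewrite big_cons f0 mul0r add0r.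
pose c (p : A * A) := p.1 u0 / f u0.
have gE : g = \sum_(p <- s) (- c p) *: p.2.
  apply/val_inj/funext => v; rewrite /= coef_fun_sum.
  apply: (mulfI fu0); have := s0 u0 v; rewrite big_cons /= => /eqP.
  rewrite addr_eq0 => /eqP ->; rewrite mulr_sumr -sumrN; apply: eq_bigr => p _.
  rewrite -[RHS]/(f u0 * (- c p * p.2 v)) mulrA mulrN mulNr.
  by rewrite /c mulrCA mulfV // mulr1.
have := ih [seq (p.1 - c p *: f, p.2) | p <- s].
rewrite size_map big_map ltnS in sk *; move=> /(_ sk).
have -> : \sum_(p <- s) B (p.1 - c p *: f) p.2 =
          \sum_(p <- (f, g) :: s) B p.1 p.2.
  rewrite big_cons /= gE bilin_sumr -big_split; apply: eq_bigr => p _ /=.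
  by rewrite bilinDl -scaleNr bilinZl bilinZr addrC.
apply=> u v; rewrite big_map.
have := s0 u v; rewrite big_cons gE coef_fun_sum => suv.
rewrite -[RHS]suv mulr_sumr -big_split; apply: eq_bigr => p _.
rewrite coef_funD coef_funN !coef_funZ /=.
by rewrite mulrDl addrC mulNr mulrA mulrN [f u * _]mulrC mulNr.
Qed.

Definition tens_lift_fun (h : tens_alg) : C :=
  \sum_(p <- sval (cid (tens_decomp h))) B p.1 p.2.

Lemma tens_lift_funE (s : seq (A * A)) :
  tens_lift_fun (\sum_(p <- s) tens_elt p.1 p.2) = \sum_(p <- s) B p.1 p.2.
Proof.
rewrite /tens_lift_fun; case: cid => /= t st.
have /tens_rel : forall u v,
    \sum_(p <- s ++ [seq (- p.1, p.2) | p <- t]) p.1 u * p.2 v = 0.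
  move=> u v; rewrite big_cat big_map /=.
  have := congr1 (fun h : tens_alg => h (u, v)) st.
  rewrite !tens_fun_sum /= => ->; rewrite -big_split big1 // => p _ /=.
  by rewrite -[X in _ + X]/(- p.1 u * p.2 v) mulNr subrr.
rewrite big_cat big_map /= => /eqP; rewrite addr_eq0 => /eqP ->.
rewrite -sumrN; apply: eq_bigr => p _.
by rewrite -[- p.1]scaleN1r bilinZl mulN1r opprK.
Qed.

Lemma tens_lift_linear : scalar tens_lift_fun.
Proof.
move=> a h h'; have [s ->] := tens_decomp h; have [t ->] := tens_decomp h'.
have -> : a *: (\sum_(p <- s) tens_elt p.1 p.2) + \sum_(p <- t) tens_elt p.1 p.2
   = \sum_(p <- [seq (a *: p.1, p.2) | p <- s] ++ t) tens_elt p.1 p.2.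
  rewrite big_cat big_map scaler_sumr; congr (_ + _); apply: eq_bigr => p _.
  by apply/val_inj/funext => u; rewrite /= -mulrA.
rewrite !tens_lift_funE big_cat big_map mulr_sumr; congr (_ + _).
by apply: eq_bigr => p _; rewrite bilinZl.
Qed.

HB.instance Definition _ :=
  GRing.isLinear.Build C tens_alg C *%R tens_lift_fun tens_lift_linear.

Definition tens_lift : {scalar tens_alg} := tens_lift_fun.

Lemma tens_liftE f g : tens_lift (tens_elt f g) = B f g.
Proof. by have := tens_lift_funE [:: (f, g)]; rewrite !big_seq1. Qed.

End Bilin.

Lemma tens_dual_ext (x y : {scalar tens_alg}) :
  (forall f g, x (tens_elt f g) = y (tens_elt f g)) -> x =1 y.
Proof.
move=> xy h; have [s ->] := tens_decomp h.
by rewrite !linear_sum; apply: eq_bigr => p _; exact: xy.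
Qed.

End TensorSquare.

Section GroupLike.
Context (C : numClosedFieldType) (n : nat).
Local Notation U := (unitary_group C n).
Local Notation A := (coef_alg C n).

(* The algebraic duals: U(U(n)) = {scalar coef_alg C n} and
   U(U(n)^2) = {scalar tens_alg C n}. *)
Local Notation UU := {scalar coef_alg C n}.

Lemma comult_bilin (x : UU) : bilin (fun f g : A => x (f * g)).
Proof.
split=> [g|f] a h h' /=.
  have -> : (a *: h + h') * g = a *: (h * g) + h' * g.
    by rewrite mulrDl; congr (_ + _); apply/val_inj/funext => u; rewrite /= -mulrA.
  by rewrite linearP.
have -> : f * (a *: h + h') = a *: (f * h) + f * h'.
  by rewrite mulrDr; congr (_ + _); apply/val_inj/funext => u; rewrite /= mulrCA.
by rewrite linearP.
Qed.

Definition comult (x : UU) : {scalar tens_alg C n} := tens_lift (comult_bilin x).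

Lemma tens_dual_bilin (x y : UU) : bilin (fun f g : A => x f * y g).
Proof.
split=> [g|f] a h h' /=; rewrite linearP.
  by rewrite mulrDl mulrA.
by rewrite mulrDr mulrCA.
Qed.

Definition tens_dual (x y : UU) : {scalar tens_alg C n} :=
  tens_lift (tens_dual_bilin x y).

Lemma comultE x f g : comult x (tens_elt f g) = x (f * g).
Proof. exact: tens_liftE. Qed.

Lemma tens_dualE x y f g : tens_dual x y (tens_elt f g) = x f * y g.
Proof. exact: tens_liftE. Qed.

Lemma dual_ext (V : lmodType C) (x y : {scalar V}) : x =1 y -> x = y.
Proof.
move=> /funext; case: x => x [[hx] [kx]]; case: y => y [[hy] [ky]] /= xy.
subst y; congr (GRing.Linear.Pack _).
by rewrite (Prop_irrelevance hx hy) (Prop_irrelevance kx ky).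
Qed.


Definition group_like : set UU :=
  [set x : UU | x <> \0 :> (A -> C) /\ comult x = tens_dual x x].

Lemma group_likeP (x : UU) : group_like x <->
  x <> \0 :> (A -> C) /\ forall f g, x (f * g) = x f * x g.
Proof.
split=> -[x0 xM]; split=> //.
  by move=> f g; rewrite -comultE xM tens_dualE.
by apply/dual_ext/tens_dual_ext => f g; rewrite comultE tens_dualE.
Qed.

Lemma coef_subproof (p : unitary_rep C n) xi eta :
  @matrix_coef C n p xi eta \in @coef_pred C n.
Proof. by apply/asboolP/lin_span_gen; exists p, xi, eta. Qed.

Definition coef (p : unitary_rep C n) (xi eta : 'cV[C]_(udim p)) : A :=
  CoefAlg (coef_subproof xi eta).

(* The operator pi(x), in the canonical basis of the space of pi. *)
Definition rep_dual (p : unitary_rep C n) (x : UU) : 'M[C]_(udim p) :=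
  \matrix_(i, j) x (coef (delta_mx j ord0 : 'cV_(udim p)) (delta_mx i ord0)).

Lemma rep_dualE (p : unitary_rep C n) (x : UU) (xi eta : 'cV[C]_(udim p)) :
  dotc (rep_dual p x *m xi) eta = x (coef xi eta).
Proof.
have -> : coef xi eta = \sum_i \sum_j (xi j ord0 * (eta i ord0)^*) *:
    coef (delta_mx j ord0 : 'cV_(udim p)) (delta_mx i ord0).
  apply/val_inj/funext => u; rewrite /= coef_fun_sum /matrix_coef /dotc.
  apply: eq_bigr => i _; rewrite coef_fun_sum mxE mulr_suml.
  apply: eq_bigr => j _; rewrite /= /matrix_coef /dotc.
  rewrite -[RHS]/(_ * (\sum_k (p (val u) *m delta_mx j ord0) k ord0 *
     ((delta_mx i ord0 : 'cV_(udim p)) k ord0)^*)).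
  rewrite (bigD1 i) //= big1 ?addr0 => [|k /negPf ki].
    rewrite -colE !mxE !eqxx conjC1 mulr1.
    by rewrite -mulrA mulrC.
  by rewrite [delta_mx i _ _ _]mxE ki conjC0 mulr0.
rewrite linear_sum /dotc; apply: eq_bigr => i _.
rewrite linear_sum mxE mulr_suml; apply: eq_bigr => j _.
by rewrite linearZ mxE /= -mulrA mulrC.
Qed.

Definition positive : set UU :=
  [set x : UU | forall p : unitary_rep C n, psdmx (rep_dual p x)].

Definition positive_group_like : set UU := group_like `&` positive.

(* F is the extension to GL(n, C) of f, obtained by linearity from the rule
   that c^pi_{xi, eta} extends to t |-> <pi(t) xi, eta>. *)
Definition GL_extension : set ((U -> C) * (general_linear C n -> C)) :=
  lin_span [set fF | exists p P xi eta, @holomorphic_ext C n p P /\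
    fF = (matrix_coef xi eta, GL_coef P xi eta)].

(* xget picks the element of a set; by Weyl's unitary trick the extension
   of f exists and is unique, and then so does the functional f |-> f(t). *)
Definition extend (f : A) : general_linear C n -> C :=
  xget (fun=> 0) [set F | GL_extension (f : U -> C, F)].

Definition evaluation (t : general_linear C n) : UU :=
  xget (\0 : UU) [set x : UU | forall f, x f = extend f t].

Definition positive_GL : set (general_linear C n) := [set t | psdmx (val t)].

End GroupLike.

(* Main.v *)
Require Import Defs.
From HB Require Import structures.
From mathcomp Require Import all_boot all_order all_algebra perm.
From mathcomp Require Import spectral sesquilinear complex mxtens ring lra.
From mathcomp Require Import all_classical all_reals all_analysis.

Set Implicit Arguments.
Unset Strict Implicit.
Unset Printing Implicit Defensive.

Import Order.TTheory GRing.Theory Num.Theory.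
Import numFieldNormedType.Exports.
Local Open Scope classical_set_scope.
Local Open Scope ring_scope.

Local Notation "M ^t*" := (M ^t*)%sesqui (at level 30).

(** Everything follows from one fact, [rep_regular]: the entries of a
    continuous unitary representation [p] of [U(n)] are restrictions of
    regular functions on [GL(n, C)], that is, of polynomials in the entries
    of [t] and in [1 / \det t].  Combined with the Zariski density of [U(n)]
    in [GL(n, C)] ([regular_density], Weyl's unitary trick), it identifies
    [C[U(n)]] with the coordinate ring of [GL(n, C)].  A group-like element
    is a nonzero multiplicative functional, hence a point of this ring: its
    values on the coordinate functions form a matrix [t], and [t] is
    invertible because the functional is multiplicative on
    [\det * \det^-1 = 1].

    Algebraicity is usually deduced from the Peter-Weyl theorem.  Here only
    finite-dimensional averages are needed, and Haar measure is replaced by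
    compactness: in the closed convex hull of the operators of a unitary
    representation, the element of least norm is fixed by the group
    ([invariant_mean]).  Applied to [q (x) p], where [q] is a matrix
    coefficient of a regular representation, it produces an operator [S],
    standing for the average of [q(v) p(v)], such that [p(u) S] is regular in
    [u].  If [q] is a high power of a function peaking at [1], then [S] is
    close to a positive multiple of the identity; so it is invertible, and
    [p(u) = (p(u) S) S^-1] is regular.  The quantitative form of this peaking
    ([peak_lower_bound]) uses that finitely many translates of a
    neighbourhood of [1] cover [U(n)].

    The regular function extending a matrix coefficient of [p] is the
    coefficient of a holomorphic representation of [GL(n, C)] by density, and
    it is the only holomorphic extension ([holomorphic_rep_unique]): by the
    singular value decomposition [GL(n, C)] is generated by [U(n)] and the
    positive diagonal one-parameter groups, and along the latter a
    holomorphic homomorphism is determined by its values on the circle.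

    Finally, the operator of [e_t] in [p] is [P(t)], with [P] the holomorphic
    extension of [p].  If [t = s s^*] is positive then
    [P(t) = P(s) P(s)^*] is positive; conversely the standard representation
    gives back [t]. *)

(** * Regular functions on the general linear group *)

Section RegularFunctions.
Context {C : numClosedFieldType} {n : nat}.
Implicit Types (F G : 'M[C]_n -> C) (t u a : 'M[C]_n).

(** The coordinate ring of [GL(n, C)].  Its elements are functions on all
    matrices, but only their values at invertible matrices are meaningful. *)
Inductive regular : ('M[C]_n -> C) -> Prop :=
| regular_cst c : regular (fun=> c)
| regular_entry i j : regular (fun t => t i j)
| regular_detV : regular (fun t => (\det t)^-1)
| regularD F G : regular F -> regular G -> regular (fun t => F t + G t)
| regularM F G : regular F -> regular G -> regular (fun t => F t * G t).

Definition regular_mx d e (P : 'M[C]_n -> 'M[C]_(d, e)) :=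
  forall i j, regular (fun t => P t i j).

Lemma regular_ext F G : F =1 G -> regular F -> regular G.
Proof. by move=> /funext ->. Qed.

Lemma regular_sum (I : Type) (r : seq I) (F : I -> 'M[C]_n -> C) :
  (forall i, regular (F i)) -> regular (fun t => \sum_(i <- r) F i t).
Proof.
move=> rF; elim: r => [|i r ih].
  by apply: regular_ext (regular_cst 0) => t; rewrite big_nil.
by apply: regular_ext (regularD (rF i) ih) => t; rewrite big_cons.
Qed.

Lemma regular_prod (I : Type) (r : seq I) (F : I -> 'M[C]_n -> C) :
  (forall i, regular (F i)) -> regular (fun t => \prod_(i <- r) F i t).
Proof.
move=> rF; elim: r => [|i r ih].
  by apply: regular_ext (regular_cst 1) => t; rewrite big_nil.
by apply: regular_ext (regularM (rF i) ih) => t; rewrite big_cons.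
Qed.

Lemma regularX F k : regular F -> regular (fun t => F t ^+ k).
Proof.
move=> rF; elim: k => [|k ih]; first exact: regular_cst.
by apply: regular_ext (regularM rF ih) => t; rewrite exprS.
Qed.

Lemma regularB F G : regular F -> regular G -> regular (fun t => F t - G t).
Proof.
move=> rF rG; apply: regular_ext (regularD rF (regularM (regular_cst (-1)) rG)).
by move=> t; rewrite mulN1r.
Qed.

Lemma regular_det d (P : 'M[C]_n -> 'M[C]_d) :
  regular_mx P -> regular (fun t => \det (P t)).
Proof.
move=> rP; apply: regular_sum => s; apply: regularM; first exact: regular_cst.
by apply: regular_prod => i; exact: rP.
Qed.

Lemma regular_mulmx d e f (P : 'M[C]_n -> 'M[C]_(d, e)) (Q : 'M[C]_n -> 'M[C]_(e, f)) :
  regular_mx P -> regular_mx Q -> regular_mx (fun t => P t *m Q t).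
Proof.
move=> rP rQ i j.
apply: (@regular_ext (fun t => \sum_k P t i k * Q t k j)).
  by move=> t; rewrite mxE.
by apply: regular_sum => k; apply: regularM; [exact: rP|exact: rQ].
Qed.

Lemma regular_mx_cst d e (M : 'M[C]_(d, e)) : regular_mx (fun=> M).
Proof. by move=> i j; exact: regular_cst. Qed.

Lemma regular_mx_id : regular_mx (fun t => t).
Proof. by move=> i j; exact: regular_entry. Qed.

(** Cramer's formula gives a regular expression of the inverse, which
    agrees with [invmx] on the units only. *)
Definition cramer_inv t : 'M[C]_n := (\det t)^-1 *: \adj t.

Lemma cramer_invE t : t \in unitmx -> cramer_inv t = invmx t.
Proof. by move=> ut; rewrite /cramer_inv /invmx ut. Qed.

Lemma regular_mx_inv : regular_mx cramer_inv.
Proof.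
move=> i j; apply: (@regular_ext (fun t => (\det t)^-1 *
    ((-1) ^+ (j + i) * \det (row' j (col' i t))))).
  by move=> t; rewrite !mxE.
apply: regularM; first exact: regular_detV.
apply: regularM; first exact: regular_cst.
apply: regular_det => k l; apply: regular_ext (regular_entry (lift j k) (lift i l)).
by move=> t; rewrite !mxE.
Qed.

Lemma regular_lmul a F : regular F -> regular (fun t => F (a *m t)).
Proof.
elim=> {F} [c|i j||F G _ rF _ rG|F G _ rF _ rG].
- exact: regular_cst.
- by apply: regular_mulmx; [exact: regular_mx_cst|exact: regular_mx_id].
- apply: regular_ext (regularM (regular_cst (\det a)^-1) regular_detV) => t.
  by rewrite det_mulmx invfM.
- exact: regularD.
- exact: regularM.
Qed.

Lemma regular_rmul a F : regular F -> regular (fun t => F (t *m a)).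
Proof.
elim=> {F} [c|i j||F G _ rF _ rG|F G _ rF _ rG].
- exact: regular_cst.
- by apply: regular_mulmx; [exact: regular_mx_id|exact: regular_mx_cst].
- apply: regular_ext (regularM (regular_cst (\det a)^-1) regular_detV) => t.
  by rewrite det_mulmx invfM mulrC.
- exact: regularD.
- exact: regularM.
Qed.

Lemma regular_adjoint F : regular F -> regular (fun t => (F (t^t*))^*).
Proof.
elim=> {F} [c|i j||F G _ rF _ rG|F G _ rF _ rG].
- exact: regular_cst.
- by apply: regular_ext (regular_entry j i) => t; rewrite !mxE conjCK.
- apply: regular_ext regular_detV => t.
  by rewrite (det_map_mx Num.conj) det_tr fmorphV /= conjCK.
- by apply: regular_ext (regularD rF rG) => t; rewrite rmorphD.
- by apply: regular_ext (regularM rF rG) => t; rewrite rmorphM.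
Qed.

(** On unitary matrices, complex conjugation is [t |-> t^-1] read on
    entries, so it preserves the restrictions of regular functions. *)
Lemma regular_conj F : regular F ->
  exists2 G, regular G & forall u, u \is unitarymx -> G u = (F u)^*.
Proof.
elim=> {F} [c|i j||F G _ [F' rF FE] _ [G' rG GE]|F G _ [F' rF FE] _ [G' rG GE]].
- by exists (fun=> c^*) => //; exact: regular_cst.
- exists (fun t => cramer_inv t j i) => [|u uu]; first exact: regular_mx_inv.
  by rewrite cramer_invE ?unitarymx_unit// invmx_unitary// !mxE.
- exists (fun t => \det t) => [|u uu]; first exact: regular_det regular_mx_id.
  have /(congr1 determinant) := unitarymxP uu.
  rewrite det_mulmx det1 det_map_mx det_tr => duv.
  have d0 : \det u != 0 by apply: contra_eq_neq duv => ->;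
    rewrite mul0r eq_sym oner_eq0.
  by apply: (mulIf (_ : (\det u)^* != 0));
    rewrite ?fmorph_eq0// duv -rmorphM mulVf//= rmorph1.
- exists (fun t => F' t + G' t) => [|u uu]; first exact: regularD.
  by rewrite rmorphD FE// GE.
- exists (fun t => F' t * G' t) => [|u uu]; first exact: regularM.
  by rewrite rmorphM FE// GE.
Qed.

End RegularFunctions.


(** * Zariski density of the unitary group *)

Section Density.
Context {C : numClosedFieldType}.

Lemma unitarymx_conjtr n (u : 'M[C]_n) : u \is unitarymx -> u^t* *m u = 1%:M.
Proof.
by move=> uu; have := uu; rewrite -trmxC_unitary => /unitarymxP; rewrite trmxCK.
Qed.

Lemma conjtr_mul d e f (A : 'M[C]_(d, e)) (B : 'M[C]_(e, f)) :
  (A *m B)^t* = B^t* *m A^t*.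
Proof. by rewrite trmx_mul map_mxM. Qed.

Lemma dotcE d (x y : 'cV[C]_d) : dotc x y = (y^t* *m x) 0 0.
Proof. by rewrite mxE; apply: eq_bigr => i _; rewrite !mxE mulrC. Qed.

Lemma conjtr_diag n (d : 'rV[C]_n) :
  (forall j, 0 <= d 0 j) -> (diag_mx d)^t* = diag_mx d.
Proof.
move=> d0; apply/matrixP => i j; rewrite !mxE eq_sym.
by case: eqP => [->|_]; rewrite ?mulr0n ?conjC0// mulr1n conj_Creal// ger0_real.
Qed.

Definition axis n (i : 'I_n) (z : C) : 'M[C]_n :=
  diag_mx (\row_j if j == i then z else 1).

Lemma axisM n (i : 'I_n) z w : axis i (z * w) = axis i z *m axis i w.
Proof.
rewrite /axis mulmx_diag; congr diag_mx; apply/rowP => j; rewrite !mxE.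
by case: eqP; rewrite // mulr1.
Qed.

Lemma axis1 n (i : 'I_n) : axis i 1 = 1%:M.
Proof.
rewrite /axis -diag_const_mx; congr diag_mx; apply/rowP => j; rewrite !mxE.
by case: eqP.
Qed.

Lemma det_axis n (i : 'I_n) z : \det (axis i z) = z.
Proof.
rewrite det_diag (bigD1 i) //= mxE eqxx big1 ?mulr1// => j /negPf ji.
by rewrite mxE ji.
Qed.

Lemma axis_unit n (i : 'I_n) z : z != 0 -> axis i z \in unitmx.
Proof. by rewrite unitmxE det_axis unitfE. Qed.

Lemma axis_unitary n (i : 'I_n) z : `|z| = 1 -> axis i z \is unitarymx.
Proof.
move=> z1; apply/unitarymxP; apply/matrixP => j k.
rewrite mul_diag_mx !mxE; have [->|jk] := eqVneq k j;
  rewrite ?mulr0n ?conjC0 ?mulr0// mulr1n.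
by case: ifP; rewrite ?conjC1 ?mulr1// -normCK z1 expr1n.
Qed.

Lemma diag_unit n (d : 'rV[C]_n) : (forall j, d 0 j != 0) -> diag_mx d \in unitmx.
Proof. by move=> d0; rewrite unitmxE det_diag unitfE prodf_seq_neq0;
  apply/allP => j _; rewrite d0. Qed.

Lemma diag_mx_ind n (Z : 'M[C]_n -> Prop) : Z 1%:M ->
  (forall i r, 0 < r -> Z (axis i r)) ->
  (forall s t, s \in unitmx -> t \in unitmx -> Z s -> Z t -> Z (s *m t)) ->
  forall d : 'rV[C]_n, (forall j, 0 < d 0 j) -> Z (diag_mx d).
Proof.
move=> Z1 Za ZM d d0.
pose D k : 'rV[C]_n := \row_j if (j < k)%N then d 0 j else 1.
have Du k : diag_mx (D k) \in unitmx.
  by apply: diag_unit => j; rewrite mxE; case: ifP => _; rewrite ?oner_eq0 ?gt_eqF.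
suff ZD k : (k <= n)%N -> Z (diag_mx (D k)).
  by have := ZD n (leqnn n); congr (Z (diag_mx _)); apply/rowP => j;
    rewrite mxE ltn_ord.
elim: k => [_|k ih kn].
  by congr (Z _): Z1; rewrite -diag_const_mx; congr diag_mx; apply/rowP => j;
    rewrite !mxE.
have -> : D k.+1 = \row_j (D k 0 j * (\row_j if j == Ordinal kn then d 0 (Ordinal kn)
  else 1) 0 j).
  apply/rowP => j; rewrite !mxE ltnS leq_eqVlt -(inj_eq val_inj) /=.
  case: (ltngtP j k) => jk; rewrite ?mulr1// mul1r; congr (d 0 _).
  exact/val_inj.
rewrite -mulmx_diag; apply: ZM => //; last 2 first.
- by apply: ih; rewrite ltnW.
- exact: Za.
- by apply: axis_unit; rewrite gt_eqF.
Qed.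

(** From the spectral decomposition [t^* t = v^* diag(l) v], with [d] the
    square root of [l] and [u = t v^* diag(d)^-1]. *)
Lemma svd n (t : 'M[C]_n) : t \in unitmx ->
  exists (u : 'M[C]_n) (d : 'rV[C]_n) (v : 'M[C]_n), [/\ u \is unitarymx, v \is
    unitarymx,
    forall j, 0 < d 0 j & t = u *m diag_mx d *m v].
Proof.
move=> tu; pose A := t^t* *m t.
have Ah : A \is hermsymmx.
  by apply/is_hermitianmxP; rewrite expr0 scale1r /A conjtr_mul trmxCK.
have /orthomx_spectralP := hermitian_normalmx Ah.
set v := spectralmx A; set l := spectral_diag A => AE.
have vu : v \is unitarymx by exact: spectral_unitarymx.
rewrite invmx_unitary// in AE.
pose B := t *m v^t*.
have BB : B^t* *m B = diag_mx l.
  rewrite /B conjtr_mul trmxCK mulmxA -(mulmxA v) -/A AE.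
  rewrite !mulmxA (unitarymxP vu) mul1mx -mulmxA.
  by rewrite (unitarymxP vu) mulmx1.
have l0 j : 0 < l 0 j.
  rewrite lt_neqAle eq_sym; apply/andP; split.
    have : B^t* *m B \in unitmx.
      have Bu : B \in unitmx by rewrite unitmx_mul tu unitarymx_unit// trmxC_unitary.
      rewrite unitmx_mul Bu andbT unitmxE (det_map_mx Num.conj) det_tr unitfE
        fmorph_eq0.
      by rewrite -unitfE -unitmxE.
    by rewrite BB unitmxE det_diag unitfE prodf_seq_neq0 => /allP/(_ j);
      rewrite mem_index_enum => /(_ isT).
  have <- : (B^t* *m B) j j = l 0 j by rewrite BB mxE eqxx mulr1n.
  by rewrite mxE sumr_ge0// => k _; rewrite !mxE mulrC mul_conjC_ge0.
pose d : 'rV[C]_n := \row_j sqrtC (l 0 j).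
have d0 j : 0 < d 0 j by rewrite mxE sqrtC_gt0.
pose e : 'rV[C]_n := \row_j (d 0 j)^-1.
have e0 j : 0 <= e 0 j by rewrite mxE invr_ge0 ltW.
have ed : diag_mx e *m diag_mx d = 1%:M.
  rewrite mulmx_diag -diag_const_mx; congr diag_mx; apply/rowP => j.
  by rewrite mxE [e 0 j]mxE mulVf ?gt_eqF// mxE.
exists (B *m diag_mx e), d, v; split=> //; last first.
  by rewrite -(mulmxA B) ed mulmx1 mulmxKtV.
rewrite -trmxC_unitary; apply/unitarymxP; rewrite trmxCK conjtr_mul.
rewrite -mulmxA (mulmxA _ B) BB conjtr_diag//.
have -> : diag_mx l = diag_mx d *m diag_mx d.
  rewrite mulmx_diag; congr diag_mx; apply/rowP => j.
  by rewrite !mxE -expr2 sqrtCK.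
have de : diag_mx d *m diag_mx e = 1%:M by apply: mulmx1C.
by rewrite -mulmxA de mulmx1 ed.
Qed.

(** This is how identities spread from [U(n)] to [GL(n, C)]: by [svd] the
    latter is generated by the former and the positive diagonal matrices. *)
Lemma GL_ind n (Z : 'M[C]_n -> Prop) :
  (forall u, u \is unitarymx -> Z u) ->
  (forall i r, 0 < r -> Z (axis i r)) ->
  (forall s t, s \in unitmx -> t \in unitmx -> Z s -> Z t -> Z (s *m t)) ->
  forall t, t \in unitmx -> Z t.
Proof.
move=> Zu Za ZM t /svd[u [d [v [uu vu d0 ->]]]].
have du : diag_mx d \in unitmx by apply: diag_unit => j; rewrite gt_eqF.
have Zd : Z (diag_mx d) by apply: diag_mx_ind => //; exact/Zu/unitarymx1.
have uM := unitarymx_unit.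
apply: (ZM); [by rewrite unitmx_mul uM// du|exact: uM| |exact: Zu].
by apply: (ZM) => //; [exact: uM|exact: Zu].
Qed.

Lemma regular_axis n (F : 'M[C]_n -> C) (i : 'I_n) : regular F ->
  exists (g : {poly C}) m, forall z, z != 0 -> z ^+ m * F (axis i z) = g.[z].
Proof.
elim=> {F} [c|j k||F G _ [f [a fE]] _ [g [b gE]]|F G _ [f [a fE]] _ [g [b gE]]].
- by exists c%:P, 0%N => z _; rewrite mul1r hornerC.
- exists (if j == k then if j == i then 'X else 1 else 0), 0%N => z _.
  rewrite mul1r /axis !mxE; case: (eqVneq j k) => [_|_]; last by rewrite mulr0n hornerC.
  by rewrite mulr1n; case: (j == i); rewrite ?hornerX ?hornerC.
- by exists 1, 1%N => z z0; rewrite det_axis hornerC mulfV.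
- exists ('X^b * f + 'X^a * g), (a + b)%N => z z0.
  rewrite hornerD !hornerM !hornerXn -fE// -gE// exprD.
  by rewrite mulrDr !mulrA [z ^+ b * _]mulrC.
- exists (f * g), (a + b)%N => z z0.
  by rewrite hornerM -fE// -gE// exprD mulrACA.
Qed.

(** The Cayley transforms of the naturals: infinitely many points of the
    unit circle, accumulating at [1]. *)
Definition cayley (k : nat) : C := (k%:R + 'i) / (k%:R - 'i).

Lemma natBi_neq0 k : k%:R - 'i != 0 :> C.
Proof.
rewrite subr_eq0; apply/eqP => ki; have : (0 : C) <= -1.
  by rewrite -sqrCi -ki exprn_ge0.
by rewrite lerNr oppr0 lt_geF// ltr01.
Qed.

Lemma cayley_inj : injective cayley.
Proof.
move=> k l /eqP; rewrite eqr_div ?natBi_neq0// -subr_eq0.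
have -> : (k%:R + 'i) * (l%:R - 'i) - (l%:R + 'i) * (k%:R - 'i) =
    'i * 2 * (l%:R - k%:R) :> C by ring.
rewrite !mulf_eq0 pnatr_eq0 orbF (negPf (neq0Ci _)) subr_eq0 eqr_nat /=.
by move/eqP.
Qed.

Lemma natBi_conj k : (k%:R - 'i : C)^* = k%:R + 'i.
Proof. by rewrite rmorphB /= conjC_nat conjCi opprK. Qed.

Lemma cayley_norm k : `|cayley k| = 1.
Proof. by rewrite normf_div -natBi_conj norm_conjC mulfV// normr_eq0 natBi_neq0. Qed.

Lemma cayleyB1 k : cayley k - 1 = 2 * 'i / (k%:R - 'i).
Proof.
apply: (mulIf (natBi_neq0 k)); rewrite divfK ?natBi_neq0// mulrBl divfK ?natBi_neq0//.
by ring.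
Qed.

Lemma norm_cayleyB1 k : (0 < k)%N -> `|cayley k - 1| <= 2 / k%:R.
Proof.
move=> k0; rewrite cayleyB1 normf_div normrM normCi mulr1 normr_nat.
rewrite ler_pM2l// lef_pV2 ?posrE ?normr_gt0 ?natBi_neq0 ?ltr0n//.
rewrite -ler_sqr ?nnegrE ?normr_ge0// normCK natBi_conj.
have -> : (k%:R - 'i) * (k%:R + 'i) = k%:R ^+ 2 + 1 :> C.
  by rewrite -[1]opprK -sqrCi; ring.
by rewrite lerDl.
Qed.

Lemma poly_circle0 (g : {poly C}) : (forall z, `|z| = 1 -> g.[z] = 0) -> g = 0.
Proof.
move=> g0; apply/eqP; apply: contraT => gn0.
have := max_poly_roots gn0 (rs := [seq cayley k | k <- iota 0 (size g)]).
rewrite size_map size_iota ltnn => -> //; rewrite ?map_inj_uniq ?iota_uniq//.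
  by apply/allP => _ /mapP[k _ ->]; apply/rootP/g0/cayley_norm.
exact: cayley_inj.
Qed.

(** Weyl's unitary trick.  The points at which every regular function
    vanishing on [U(n)] vanishes form a submonoid, because translates of
    regular functions are regular.  It contains the diagonal one-parameter
    groups, on which a regular function is a Laurent polynomial and hence
    determined by its values on the unit circle. *)
Lemma regular_density n (F : 'M[C]_n -> C) : regular F ->
  (forall u, u \is unitarymx -> F u = 0) -> forall t, t \in unitmx -> F t = 0.
Proof.
move=> rF F0 t tu; pose Z (t : 'M[C]_n) := forall F, regular F ->
  (forall u, u \is unitarymx -> F u = 0) -> F t = 0.
suff : Z t by exact.
move: tu; apply: GL_ind => {t F rF F0} [u uu F _|i r r0 F rF F0|s t _ _ Zs Zt F rF F0].
- exact.
- have [g [m gE]] := regular_axis i rF.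
  have g0 : g = 0.
    apply: poly_circle0 => z z1; rewrite -gE ?F0 ?mulr0 ?axis_unitary//.
    by rewrite -normr_eq0 z1 oner_eq0.
  have /eqP := gE r (lt0r_neq0 r0).
  by rewrite g0 horner0 mulf_eq0 expf_eq0 gt_eqF// andbF => /eqP.
- apply: (Zs (fun s => F (s *m t))); first exact: regular_rmul.
  move=> u uu; apply: (Zt (fun t => F (u *m t))); first exact: regular_lmul.
  by move=> v uv; apply: F0; exact: mul_unitarymx.
Qed.

Lemma regular_eq n (F G : 'M[C]_n -> C) : regular F -> regular G ->
  (forall u, u \is unitarymx -> F u = G u) ->
  forall t, t \in unitmx -> F t = G t.
Proof.
move=> rF rG FG t tu; apply/eqP; rewrite -subr_eq0; apply/eqP.
apply: (regular_density (regularB rF rG)) => // u uu.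
by rewrite FG// subrr.
Qed.

Lemma regular_mx_eq n d e (P Q : 'M[C]_n -> 'M[C]_(d, e)) :
  regular_mx P -> regular_mx Q -> (forall u, u \is unitarymx -> P u = Q u) ->
  forall t, t \in unitmx -> P t = Q t.
Proof.
move=> rP rQ PQ t tu; apply/matrixP => i j.
by apply: (regular_eq (rP i j) (rQ i j)) => // u uu; rewrite PQ.
Qed.

(** The unitary trick at work: multiplicativity spreads from [U(n)] to
    [GL(n, C)], one variable after the other. *)
Lemma regular_mx_mul n d (P : 'M[C]_n -> 'M[C]_d) : regular_mx P ->
  (forall u v, u \is unitarymx -> v \is unitarymx -> P (u *m v) = P u *m P v) ->
  forall s t, s \in unitmx -> t \in unitmx -> P (s *m t) = P s *m P t.
Proof.
move=> rP PM s t su tu.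
apply: (regular_mx_eq (P := fun s => P (s *m t)) (Q := fun s => P s *m P t)) su.
- by move=> i j; exact: (regular_rmul t (rP i j)).
- by apply: regular_mulmx => //; exact: regular_mx_cst.
move=> u uu.
apply: (regular_mx_eq (P := fun t => P (u *m t)) (Q := fun t => P u *m P t)) tu.
- by move=> i j; exact: (regular_lmul u (rP i j)).
- by apply: regular_mulmx => //; exact: regular_mx_cst.
by move=> v uv; exact: PM.
Qed.

Lemma regular_mx_adjoint n d (P : 'M[C]_n -> 'M[C]_d) : regular_mx P ->
  (forall u, u \is unitarymx -> P (u^t*) = (P u)^t*) ->
  forall t, t \in unitmx -> P (t^t*) = (P t)^t*.
Proof.
move=> rP PA t tu; rewrite -[LHS]trmxCK; congr (_ ^t*).
apply: (regular_mx_eq (P := fun t => (P (t^t*))^t*)) tu => // [i j|u uu].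
  by apply: regular_ext (regular_adjoint (rP j i)) => s; rewrite !mxE.
by rewrite PA// trmxCK.
Qed.

End Density.


(** * Differentiability of regular functions *)

Section Differentiability.
Context {C : numClosedFieldType} {n : nat}.

Lemma differentiable_det (t : 'M[C]_n) : differentiable (fun t : 'M[C]_n => \det t) t.
Proof.
have dprod (s : {perm 'I_n}) (r : seq 'I_n) :
    differentiable (fun t : 'M[C]_n => \prod_(i <- r) t i (s i)) t.
  elim: r => [|i r ih].
    by under eq_fun do rewrite big_nil; exact: differentiable_cst.
  under eq_fun do rewrite big_cons.
  by apply: differentiableM => //; exact: differentiable_coord.
have dsum (r : seq {perm 'I_n}) : differentiable (fun t : 'M[C]_n =>
    \sum_(s <- r) (-1) ^+ s * \prod_i t i (s i)) t.
  elim: r => [|s r ih].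
    by under eq_fun do rewrite big_nil; exact: differentiable_cst.
  under eq_fun do rewrite big_cons.
  apply: differentiableD => //; apply: differentiableM => //.
exact: dsum.
Qed.

Lemma regular_differentiable (F : 'M[C]_n -> C) (t : 'M[C]_n) :
  regular F -> t \in unitmx -> differentiable F t.
Proof.
move=> rF tu; elim: rF => {F} [c|i j||F G _ dF _ dG|F G _ dF _ dG].
- exact: differentiable_cst.
- exact: differentiable_coord.
- apply: (@differentiableV _ _ (fun t => \det t)); first exact: differentiable_det.
  by rewrite -unitfE -unitmxE.
- exact: differentiableD.
- exact: differentiableM.
Qed.

Lemma regular_mx_differentiable d e (P : 'M[C]_n -> 'M[C]_(d, e)) (t : 'M[C]_n) :
  regular_mx P -> t \in unitmx -> differentiable P t.
Proof.
move=> rP tu.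
have -> : P = \sum_i \sum_j (fun t => P t i j *: (delta_mx i j : 'M[C]_(d, e))).
  apply/funext => s; rewrite [LHS]matrix_sum_delta fct_sumE; apply: eq_bigr => i _.
  by rewrite fct_sumE.
apply: differentiable_sum => i; apply: differentiable_sum => j.
apply: (differentiableZl (k := fun t => P t i j)).
exact: (regular_differentiable (rP i j)).
Qed.

End Differentiability.


(** * Uniqueness of holomorphic extensions *)

Section Radial.
Context {R : realType}.
(* [R[i]] with its closed field structure, from which its topology derives *)
Local Notation C := (complex_complex__canonical__Num_ClosedField R).

Lemma differentiable_approx (K : numFieldType) (f : K -> K) (x : K) :
  differentiable f x ->
  exists c : K, forall e, 0 < e -> exists2 d, 0 < d &
    forall h, `|h| < d -> `|f (x + h) - f x - c * h| <= e * `|h|.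
Proof.
move=> /diff_locallyP[_ /eqaddoP fo]; exists ('d f x 1) => e e0.
have /nbhs_norm0P[d /= d0 dP] := fo _ e0.
exists d => // h /dP; rewrite !fctE /= [h + x]addrC opprD addrA.
suff -> : 'd f x h = 'd f x 1 * h by [].
by rewrite -{1}[h]mulr1 -[h * 1]/(h *: (1 : K)) linearZ /= mulrC.
Qed.

Lemma complex_gt0 (d : C) : 0 < d -> exists2 r : R, 0 < r & d = (r%:C)%C.
Proof.
move=> d0; exists (complex.Re d).
  by move: d0; rewrite ltcE => /andP[].
by rewrite RRe_real// gtr0_real.
Qed.

Lemma circle_near1 (d : C) : 0 < d ->
  exists z : C, [/\ `|z| = 1, z != 1 & `|z - 1| < d].
Proof.
move=> /complex_gt0[r r0 ->].
pose k := (Num.truncn (2 / r)).+1.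
have kr : 2 / r < k%:R by rewrite /k truncnS_gt.
exists (cayley k); split; first exact: cayley_norm.
  by rewrite -subr_eq0 cayleyB1 !mulf_neq0 ?invr_neq0 ?natBi_neq0 ?pnatr_eq0 ?neq0Ci.
apply: le_lt_trans (norm_cayleyB1 _) _ => //.
have -> : 2 / k%:R = ((2 / k%:R)%:C)%C :> C by rewrite rmorphM fmorphV !rmorph_nat.
by rewrite ltcR ltr_pdivrMr ?ltr0n// mulrC -ltr_pdivrMr.
Qed.

Lemma normc_ge_Im (z : C) : (`|complex.Im z|%:C)%C <= `|z|.
Proof.
case: z => a b.
by rewrite normc_def lecR /= -[leLHS]sqrtr_sqr ler_wsqrtr// lerDr sqr_ge0.
Qed.

(** A complex derivative can be computed along any curve.  For a rotation
    invariant function the circle through [x] gives the value zero. *)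
Lemma radial_derivative0 (f : C -> C) (x : C) : x != 0 -> differentiable f x ->
  (forall z, `|z| = 1 -> f (x * z) = f x) ->
  forall e, 0 < e -> exists2 d, 0 < d &
    forall h, `|h| < d -> `|f (x + h) - f x| <= e * `|h|.
Proof.
move=> x0 /differentiable_approx[c cP] fx.
suff c0 : c = 0.
  by move=> e /cP[d d0 dP]; exists d => // h /dP; rewrite c0 mul0r subr0.
apply/eqP; apply: contraT => c0.
have nx : 0 < `|x| by rewrite normr_gt0.
have nc : 0 < `|c| by rewrite normr_gt0.
have [d d0 dP] := cP (`|c| / 2) (divr_gt0 nc (ltr0n _ 2)).
have [z [z1 zn1 zd]] := circle_near1 (divr_gt0 d0 nx).
have xz : x + x * (z - 1) = x * z by ring.
have yd : `|x * (z - 1)| < d by rewrite normrM mulrC -ltr_pdivlMr.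
have y0 : 0 < `|x * (z - 1)| by rewrite normr_gt0 mulf_neq0// subr_eq0.
have := dP _ yd; rewrite xz fx// subrr sub0r normrN [`|c * _|]normrM.
rewrite ler_pM2r// ler_pMr// => h.
by have := le_lt_trans h (_ : 2^-1 < 1); rewrite ltxx => -> //;
  rewrite invf_lt1 ?ltr0n// ltr1n.
Qed.

Lemma real_derivative0 (g : R -> R) (x : R) :
  (forall e, 0 < e -> exists2 d, 0 < d &
    forall h, `|h| < d -> `|g (x + h) - g x| <= e * `|h|) ->
  is_derive x 1 g 0.
Proof.
move=> gx.
have q0 : (fun h : R => h^-1 *: (g (h *: (1 : R) + x) - g x)) @ 0^' --> (0 : R).
  apply/cvgr0Pnorm_le => e e0; have [d d0 dP] := gx e e0.
  near=> h; have h0 : h != 0 by near: h; exact: nbhs_dnbhs_neq.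
  rewrite normrM normfV mulrC ler_pdivrMr ?normr_gt0//.
  rewrite [h *: 1]mulr1 [h + x]addrC; apply: dP.
  by near: h; exact: dnbhs0_lt.
by split; [exact: cvgP q0|exact/cvg_lim].
Unshelve. all: by end_near. Qed.

Lemma derivative0_const (g : R -> R) (a b : R) : 0 < a -> a <= b ->
  (forall x : R, 0 < x -> is_derive x 1 g 0) -> g a = g b.
Proof.
move=> a0 ab dg; apply/eqP; rewrite -subr_eq0 -normr_eq0 distrC normr_eq0.
have [||c _ ->] := @MVT_segment R g (fun=> 0) a b ab.
- by move=> x /andP[ax _]; apply: dg; exact: lt_trans ax.
- apply: derivable_within_continuous => x /andP[ax _].
  by have [] := dg x (lt_le_trans a0 ax).
- by rewrite mul0r.
Qed.

(** A rotation invariant holomorphic function on [C^*] has derivative zero,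
    so its real and imaginary parts are constant on the positive half-line. *)
Lemma radial_const (f : C -> C) (r : R) :
  (forall z : C, z != 0 -> differentiable f z) ->
  (forall z w : C, z != 0 -> `|w| = 1 -> f (z * w) = f z) ->
  0 < r -> f (r%:C)%C = f 1.
Proof.
move=> df fw r0.
have part (p : C -> R) : {morph p : x y / x - y} ->
    (forall z, (`|p z|%:C)%C <= `|z|) -> p (f (r%:C)%C) = p (f 1).
  move=> pB pn; pose g (x : R) : R := p (f (x%:C)%C).
  have dg (x : R) : 0 < x -> is_derive x 1 g 0.
    move=> x0; have xC0 : (x%:C)%C != 0 :> C by rewrite eq_complex /= eqxx andbT gt_eqF.
    apply: real_derivative0 => e e0.
    have eC : (0 : C) < (e%:C)%C by rewrite ltcR.
    have [d /complex_gt0[d' d0 ->] dP] := radial_derivative0 xC0 (df _ xC0) (fun w =>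
      fw _ w xC0) eC.
    have nR (h : R) : `|(h%:C)%C : C| = (`|h|%:C)%C by rewrite normc_def /= expr0n
      addr0 sqrtr_sqr.
    exists d' => // h hd; rewrite /g rmorphD -pB -lecR; apply: le_trans (pn _) _.
    rewrite rmorphM /= -nR; apply: dP.
    by rewrite nR ltcR.
  by have [r1|r1] := leP r 1;
    [apply: derivative0_const|apply/esym/derivative0_const] => //; exact: ltW.
rewrite [LHS]complexE [RHS]complexE; congr (_%:C + _ * _%:C)%C.
  apply: part => [[a b] [c d]//|z]; exact: normc_ge_Re.
by apply: part => [[a b] [c d]//|z]; exact: normc_ge_Im.
Qed.

Lemma differentiable_axis n (i : 'I_n) (z : C) : differentiable (@axis C n i) z.
Proof.
have -> : @axis C n i = (fun z => z *: delta_mx i i) + cst (axis i 0).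
  apply/funext => w; apply/matrixP => j k; rewrite !fctE /axis !mxE.
  case: (eqVneq j i) => [->|_] /=; last by rewrite mulr0 add0r.
  by rewrite mul0rn addr0 mulr_natr eq_sym.
apply: differentiableD; last exact: differentiable_cst.
exact: differentiableZl.
Qed.

(** Along a diagonal one-parameter group, the quotient
    [z |-> P (axis i z) * Q (axis i z)^-1] is rotation invariant because [P]
    and [Q] agree on the circle; so it is constant on the half-line. *)
Lemma holomorphic_rep_unique n d (P Q : 'M[C]_n -> 'M[C]_d) :
  [/\ P 1%:M = 1%:M,
    forall s t, s \in unitmx -> t \in unitmx -> P (s *m t) = P s *m P t
    & forall t : 'M[C]_n, t \in unitmx -> differentiable P t] ->
  [/\ Q 1%:M = 1%:M,
    forall s t, s \in unitmx -> t \in unitmx -> Q (s *m t) = Q s *m Q t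
    & forall t : 'M[C]_n, t \in unitmx -> differentiable Q t] ->
  (forall u, u \is unitarymx -> P u = Q u) ->
  forall t, t \in unitmx -> P t = Q t.
Proof.
move=> [P1 PM dP] [Q1 QM dQ] PQ; apply: GL_ind => [u uu|i r r0|s t su tu Ps Pt].
- exact: PQ.
- have au (z : C) : z != 0 -> axis i z \in unitmx by exact: axis_unit.
  have r0C : r != 0 by rewrite gt_eqF.
  pose E z := P (axis i z) *m Q (axis i z^-1).
  have QV (z : C) : z != 0 -> Q (axis i z^-1) *m Q (axis i z) = 1%:M.
    by move=> z0; rewrite -QM ?au ?invr_neq0// -axisM mulVf// axis1.
  suff Er : E r = 1%:M by rewrite -[LHS]mulmx1 -(QV r)// mulmxA -/(E r) Er mul1mx.
  have [r' r'0 ->] := complex_gt0 r0.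
  apply/matrixP => k l.
  rewrite (@radial_const (fun z => E z k l))//.
  + by rewrite /E invr1 axis1 P1 Q1 mulmx1.
  + move=> z z0.
    have -> : (fun z => E z k l) = \sum_j (fun z => P (axis i z) k j * Q (axis i
      z^-1) j l).
      by apply/funext => w; rewrite /E mxE fct_sumE.
    apply: differentiable_sum => j; apply: differentiableM.
      apply: (differentiable_comp (f := P \o axis i) (g := fun M => M k j)).
        by apply: differentiable_comp; [exact: differentiable_axis|apply: dP;
          exact: au].
      exact: differentiable_coord.
    apply: (differentiable_comp (f := (Q \o axis i) \o GRing.inv) (g := fun M => M j
      l)).
      apply: differentiable_comp; first exact: differentiable_Rinv.
      by apply: differentiable_comp; [exact: differentiable_axis|apply: dQ;
        rewrite au ?invr_neq0].
    exact: differentiable_coord.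
  + move=> z w z0 w1.
    have w0 : w != 0 by rewrite -normr_eq0 w1 oner_eq0.
    congr (fun_of_matrix _ k l);
      rewrite /E axisM PM ?au// (PQ (axis i w)) ?axis_unitary//.
    rewrite invfM [z^-1 * _]mulrC axisM QM ?au ?invr_neq0//.
    rewrite -mulmxA (mulmxA (Q (axis i w))) -QM ?au ?invr_neq0// -axisM mulfV//.
    by rewrite axis1 Q1 mul1mx.
- by rewrite PM// QM// Ps Pt.
Qed.

End Radial.


(** * Unitary representations with regular entries *)

Section RegularCoefficients.
Context {C : numClosedFieldType} {n : nat}.
Implicit Types p q : unitary_rep C n.

Lemma regular_mx_within_continuous d (P : 'M[C]_n -> 'M[C]_d) : regular_mx P ->
  {within [set u | u \is unitarymx], continuous P}.
Proof.
move=> rP; apply: continuous_in_subspaceT => u; rewrite inE /= => uu.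
apply: differentiable_continuous; apply: regular_mx_differentiable => //.
exact: unitarymx_unit.
Qed.

Definition regular_rep d (P : 'M[C]_n -> 'M[C]_d) (rP : regular_mx P)
    (P1 : P 1%:M = 1%:M)
    (PM : forall u v, u \is unitarymx -> v \is unitarymx -> P (u *m v) = P u *m P v)
    (PU : forall u, u \is unitarymx -> P u \is unitarymx) : unitary_rep C n :=
  UnitaryRep P1 PM PU (regular_mx_within_continuous rP).

Definition std_rep : unitary_rep C n :=
  @regular_rep n id regular_mx_id erefl (fun _ _ _ _ => erefl) (fun _ uu => uu).

Lemma regular_detV_mx : regular_mx (fun t : 'M[C]_n => ((\det t)^-1)%:M : 'M[C]_1).
Proof.
by move=> i j; apply: regular_ext regular_detV => t; rewrite !ord1 mxE eqxx mulr1n.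
Qed.

Lemma detV_unitary (u : 'M[C]_n) : u \is unitarymx ->
  ((\det u)^-1)%:M \is @unitarymx C 1 1.
Proof.
move=> uu; apply/unitarymxP; rewrite tr_scalar_mx (map_scalar_mx Num.conj) -scalar_mxM.
have /(congr1 determinant) := unitarymxP uu.
by rewrite det_mulmx det1 (det_map_mx Num.conj) det_tr fmorphV -invfM => ->;
  rewrite invr1.
Qed.

Lemma detV1 : ((\det (1%:M : 'M[C]_n))^-1)%:M = 1%:M :> 'M[C]_1.
Proof. by rewrite det1 invr1. Qed.

Lemma detVM (u v : 'M[C]_n) : ((\det (u *m v))^-1)%:M =
  ((\det u)^-1)%:M *m ((\det v)^-1)%:M :> 'M[C]_1.
Proof. by rewrite det_mulmx invfM scalar_mxM. Qed.

Definition detV_rep : unitary_rep C n :=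
  regular_rep regular_detV_mx detV1 (fun u v _ _ => detVM u v) detV_unitary.

Definition dsum_act p q (u : 'M[C]_n) : 'M[C]_(udim p + udim q) :=
  block_mx (p u) 0 0 (q u).

Lemma dsum_act1 p q : dsum_act p q 1%:M = 1%:M.
Proof. by rewrite /dsum_act !uact1 -scalar_mx_block. Qed.

Lemma dsum_actM p q u v : u \is unitarymx -> v \is unitarymx ->
  dsum_act p q (u *m v) = dsum_act p q u *m dsum_act p q v.
Proof.
move=> uu uv; rewrite /dsum_act mulmx_block !uactM//.
by rewrite !mulmx0 !mul0mx !addr0 !add0r.
Qed.

Lemma dsum_act_unitary p q u : u \is unitarymx -> dsum_act p q u \is unitarymx.
Proof.
move=> uu; apply/unitarymxP; rewrite /dsum_act tr_block_mx (map_block_mx Num.conj).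
rewrite mulmx_block !(unitarymxP (uact_unitary _ uu)) !trmx0 !map_mx0.
by rewrite !mulmx0 !mul0mx !addr0 !add0r -scalar_mx_block.
Qed.

Lemma regular_dsum p q : regular_mx p -> regular_mx q -> regular_mx (dsum_act p q).
Proof.
move=> rp rq i j.
case: (split_ordP i) => k ->; case: (split_ordP j) => l ->.
- by apply: regular_ext (rp k l) => t; rewrite block_mxEul.
- by apply: regular_ext (regular_cst 0) => t; rewrite block_mxEur mxE.
- by apply: regular_ext (regular_cst 0) => t; rewrite block_mxEdl mxE.
- by apply: regular_ext (rq k l) => t; rewrite block_mxEdr.
Qed.

Lemma dotc_col d e (x y : 'cV[C]_d) (x' y' : 'cV[C]_e) :
  dotc (col_mx x x') (col_mx y y') = dotc x y + dotc x' y'.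
Proof.
by rewrite /dotc big_split_ord; congr (_ + _); apply: eq_bigr => i _;
  rewrite ?col_mxEu ?col_mxEd.
Qed.

(** The regular functions are the matrix coefficients of the unitary
    representations with regular entries: such coefficients are stable under
    sums and products through direct sums and tensor products. *)
Lemma regular_matrix_coef (F : 'M[C]_n -> C) : regular F ->
  exists p (xi eta : 'cV[C]_(udim p)), regular_mx p /\
    forall u, u \is unitarymx -> F u = dotc (p u *m xi) eta.
Proof.
elim=> {F} [c|i j||F G _ [p [x [y [rp pE]]]] _ [q [x' [y' [rq qE]]]]
  |F G _ [p [x [y [rp pE]]]] _ [q [x' [y' [rq qE]]]]].
- exists (one_rep C n), (const_mx c), (const_mx 1); split; first exact: regular_mx_cst.
  by move=> u _; rewrite /dotc big_ord1 mul1mx !mxE conjC1 mulr1.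
- exists std_rep, (delta_mx j 0), (delta_mx i 0); split; first exact: regular_mx_id.
  move=> u _; rewrite /dotc (bigD1 i) //= big1 ?addr0 => [|k /negPf ki].
    by rewrite -colE !mxE !eqxx conjC1 mulr1.
  by rewrite [delta_mx i _ _ _]mxE ki conjC0 mulr0.
- exists detV_rep, (const_mx 1), (const_mx 1); split; first exact: regular_detV_mx.
  by move=> u _; rewrite /dotc big_ord1 mul_scalar_mx !mxE conjC1 !mulr1.
- exists (@UnitaryRep C n _ _ (dsum_act1 p q) (@dsum_actM p q) (@dsum_act_unitary p q)
    (regular_mx_within_continuous (regular_dsum rp rq))), (col_mx x x'), (col_mx y y').
  split=> [|u uu]; first exact: regular_dsum.
  by rewrite /= /dsum_act mul_block_col !mul0mx addr0 add0r dotc_col pE// qE.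
- exists (tens_rep p q),
    (\col_k (x (mxtens_unindex k).1 ord0 * x' (mxtens_unindex k).2 ord0)),
    (\col_k (y (mxtens_unindex k).1 ord0 * y' (mxtens_unindex k).2 ord0)).
  split=> [i j|u uu]; last first.
    rewrite pE// qE//.
    have := matrix_coef_tens x y x' y'.
    by move/(congr1 (fun f : unitary_group C n -> C => f (exist _ u uu))).
  apply: regular_ext (regularM (rp (mxtens_unindex i).1 (mxtens_unindex j).1)
    (rq (mxtens_unindex i).2 (mxtens_unindex j).2)) => t.
  by rewrite mxE.
Qed.

End RegularCoefficients.


(** * Averages over the unitary group *)

Section InvariantMean.
Context {R : realType}.
Local Notation C := (complex_complex__canonical__Num_ClosedField R).

Lemma continuous_sumr (K : numFieldType) (T : topologicalType) (V : normedModType K)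
    (I : Type) (r : seq I) (f : I -> T -> V) :
  (forall i, continuous (f i)) -> continuous (fun x => \sum_(i <- r) f i x).
Proof.
move=> fc; elim: r => [|i r ih] x.
  under [X in continuous_at _ X]eq_fun do rewrite big_nil.
  exact: cvg_cst.
have -> : (fun x => \sum_(k <- i :: r) f k x) = (fun x => f i x + \sum_(k <- r) f k x).
  by apply/funext => y; rewrite big_cons.
by apply: cvgD; [exact: fc|exact: ih].
Qed.

Lemma norm_real_complex (x : R) : `|(x%:C)%C : C| = (`|x|%:C)%C.
Proof. by rewrite normc_def /= expr0n addr0 sqrtr_sqr. Qed.

Lemma uniform_continuous (K L : numFieldType) (V : normedModType K)
    (W : normedModType L) (f : V -> W) :
  (forall e, 0 < e -> exists2 d, 0 < d &
    forall x y, `|x - y| < d -> `|f x - f y| < e) -> continuous f.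
Proof.
move=> fu x; apply/cvgrPdist_lt => e /fu[d d0 dP].
by apply/nbhs_normP; exists d => // y; exact: dP.
Qed.

Lemma Re_continuous : continuous (fun z : C => complex.Re z).
Proof.
apply: uniform_continuous => e e0; exists (e%:C)%C => [|x y xy]; first by rewrite ltcR.
have -> : complex.Re x - complex.Re y = complex.Re (x - y).
  by case: x y {xy} => [? ?] [? ?].
by rewrite -ltcR; apply: le_lt_trans (normc_ge_Re _) xy.
Qed.

Lemma Im_continuous : continuous (fun z : C => complex.Im z).
Proof.
apply: uniform_continuous => e e0; exists (e%:C)%C => [|x y xy]; first by rewrite ltcR.
have -> : complex.Im x - complex.Im y = complex.Im (x - y).
  by case: x y {xy} => [? ?] [? ?].
by rewrite -ltcR; apply: le_lt_trans (normc_ge_Im _) xy.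
Qed.

Definition square_box (b : R) : set C :=
  [set z | `|complex.Re z| <= b /\ `|complex.Im z| <= b].

Lemma square_box_compact b : compact (square_box b).
Proof.
pose f (xy : R * R) : C := (xy.1%:C)%C + 'i * (xy.2%:C)%C.
have -> : square_box b = f @` (`[-b, b] `*` `[-b, b])%classic.
  apply/seteqP; split=> [z [zr zi]|_ [[x y] /= [xb yb] <-]].
    exists (complex.Re z, complex.Im z); last by rewrite /f [RHS]complexE.
    by split; rewrite /= in_itv /= -ler_norml.
  by move: xb yb; rewrite /square_box /f !in_itv /= -!ler_norml; simpc.
apply: continuous_compact; last by apply: compact_setX; exact: segment_compact.
apply: continuous_subspaceT; apply: uniform_continuous => _ /complex_gt0[e e0 ->].
exists (e / 2) => [|[a c] [a' c']]; first by rewrite divr_gt0.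
rewrite prod_normE gt_max /= => /andP[aa cc].
have -> : f (a, c) - f (a', c') = ((a - a')%:C)%C + 'i * ((c - c')%:C)%C :> C.
  by rewrite /f /= !rmorphB /=; ring.
apply: le_lt_trans (ler_normD _ _) _.
rewrite normrM normCi mul1r !norm_real_complex -rmorphD ltcR; lra.
Qed.

Lemma vec_mx_continuous (K : numFieldType) d e :
  continuous (vec_mx : 'rV[K]_(d * e) -> 'M[K]_(d, e)).
Proof.
move=> v; apply: (@cvg_mx _ _ (nbhs v) (nbhs_filter v)) => i j.
have -> : (fun v : 'rV[K]_(d * e) => vec_mx v i j) = (fun v => v ord0 (mxvec_index i
  j)).
  by apply/funext => w; rewrite mxE.
by rewrite mxE; exact: coord_continuous.
Qed.

Lemma mx_box_compact d e b :
  compact [set X : 'M[C]_(d, e) | forall i j, square_box b (X i j)].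
Proof.
have -> : [set X : 'M[C]_(d, e) | forall i j, square_box b (X i j)] =
    vec_mx @` [set v : 'rV[C]_(d * e) | forall k, square_box b (v ord0 k)].
  apply/seteqP; split=> [X Xb|_ [v vb <-] i j]; last by rewrite mxE; exact: vb.
  by exists (mxvec X); rewrite ?mxvecK// => k; case: (mxvec_indexP k) => i j;
    rewrite mxvecE.
apply: continuous_compact; last first.
  apply: (@rV_compact _ _ (fun=> square_box b)) => _; exact: square_box_compact.
by apply: continuous_subspaceT; exact: vec_mx_continuous.
Qed.

Definition hs_norm2 d e (X : 'M[C]_(d, e)) : R :=
  \sum_i \sum_j (complex.Re (X i j) ^+ 2 + complex.Im (X i j) ^+ 2).

Lemma hs_norm2E d e (X : 'M[C]_(d, e)) : (hs_norm2 X)%:C%C = \tr (X *m X^t*).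
Proof.
rewrite /hs_norm2 rmorph_sum; apply: eq_bigr => i _; rewrite rmorph_sum mxE.
by apply: eq_bigr => j _; rewrite !mxE [LHS]add_Re2_Im2 normCK.
Qed.

Lemma hs_norm2_unitary d e (u : 'M[C]_d) (X : 'M[C]_(d, e)) : u \is unitarymx ->
  hs_norm2 (u *m X) = hs_norm2 X.
Proof.
move=> uu; apply: complexI; rewrite !hs_norm2E conjtr_mul.
by rewrite mxtrace_mulC !mulmxA mulmxKtV// mxtrace_mulC.
Qed.

Lemma hs_norm2_ge0 d e (X : 'M[C]_(d, e)) : 0 <= hs_norm2 X.
Proof. by apply: sumr_ge0 => i _; apply: sumr_ge0 => j _;
  rewrite addr_ge0 ?sqr_ge0. Qed.

Lemma hs_norm2_entry d e (X : 'M[C]_(d, e)) i j :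
  complex.Re (X i j) ^+ 2 + complex.Im (X i j) ^+ 2 <= hs_norm2 X.
Proof.
rewrite /hs_norm2 (bigD1 i) //= (bigD1 j) //= -addrA lerDl.
have s k l : 0 <= complex.Re (X k l) ^+ 2 + complex.Im (X k l) ^+ 2 by rewrite
  addr_ge0 ?sqr_ge0.
by rewrite addr_ge0 ?sumr_ge0// => k _; rewrite sumr_ge0.
Qed.

Lemma hs_norm2_eq0 d e (X : 'M[C]_(d, e)) : hs_norm2 X <= 0 -> X = 0.
Proof.
move=> X0; apply/matrixP => i j; rewrite mxE; apply/eqP.
have := le_trans (hs_norm2_entry X i j) X0.
rewrite le_eqVlt ltNge addr_ge0 ?sqr_ge0// orbF paddr_eq0 ?sqr_ge0// !sqrf_eq0.
by rewrite eq_complex.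
Qed.

Lemma hs_norm2_continuous d e : continuous (@hs_norm2 d e).
Proof.
apply: continuous_sumr => i; apply: continuous_sumr => j.
have cRe : continuous (fun X : 'M[C]_(d, e) => complex.Re (X i j)).
  by move=> X; apply: continuous_comp; [exact: coord_continuous|exact: Re_continuous].
have cIm : continuous (fun X : 'M[C]_(d, e) => complex.Im (X i j)).
  by move=> X; apply: continuous_comp; [exact: coord_continuous|exact: Im_continuous].
have sq (f : 'M[C]_(d, e) -> R) : continuous f -> continuous (fun X => f X ^+ 2).
  move=> fc X; have -> : (fun X => f X ^+ 2) = f * f by apply/funext => Y;
    rewrite expr2.
  exact: continuousM (fc X) (fc X).
by move=> X; exact: continuousD (sq _ cRe X) (sq _ cIm X).
Qed.

(** These are all the real-linear functionals on matrices, whence their use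
    below to describe half-spaces. *)
Lemma Re_trace_continuous d e (B : 'M[C]_(e, d)) :
  continuous (fun X : 'M[C]_(d, e) => complex.Re (\tr (B *m X))).
Proof.
move=> X.
apply: (@continuous_comp _ _ _ (fun X => \tr (B *m X)) (fun z : C => complex.Re z));
  last exact: Re_continuous.
apply: continuous_sumr => i {}X.
have -> : (fun X : 'M[C]_(d, e) => (B *m X) i i) = (fun X => \sum_j B i j * X j i).
  by apply/funext => Y; rewrite mxE.
apply: continuous_sumr => j {}X.
apply: (@continuousM _ _ (fun=> B i j) (fun X : 'M[C]_(d, e) => X j i)).
  exact: cst_continuous.
exact: coord_continuous.
Qed.

Lemma unitary_entry_le1 d (u : 'M[C]_d) i j : u \is unitarymx -> `|u i j| <= 1.
Proof.
move=> uu; rewrite -[leRHS]normr1 -ler_sqr ?nnegrE// normr1 expr1n.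
have := congr1 (fun M : 'M[C]_d => M i i) (unitarymxP uu).
rewrite /= !mxE eqxx mulr1n => <-; rewrite (bigD1 j) //= !mxE -normCK lerDl.
by apply: sumr_ge0 => k _; rewrite !mxE -normCK exprn_ge0.
Qed.

Lemma unitary_entry d (u : 'M[C]_d) i j : u \is unitarymx ->
  `|complex.Re (u i j)| <= 1 /\ `|complex.Im (u i j)| <= 1.
Proof.
move=> /(unitary_entry_le1 i j) u1.
by split; rewrite -lecR; apply: le_trans u1; [exact: normc_ge_Re|exact: normc_ge_Im].
Qed.

Context (n : nat).

(** The closed convex hull of the operators [p v].  Described by half-spaces,
    it makes every linear inequality valid on [U(n)] valid on average. *)
Definition orbit_hull (p : unitary_rep C n) : set 'M[C]_(udim p) :=
  [set X | forall B r,
    (forall v, v \is unitarymx -> r <= complex.Re (\tr (B *m p v))) ->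
    r <= complex.Re (\tr (B *m X))].

Lemma orbit_hull_closed p : closed (@orbit_hull p).
Proof.
have -> : @orbit_hull p = \bigcap_(Br in [set Br | forall v, v \is unitarymx ->
    Br.2 <= complex.Re (\tr (Br.1 *m p v))]) [set X | Br.2 <= complex.Re (\tr (Br.1
      *m X))].
  apply/seteqP; split=> [X hX [B r] /= /hX//|X hX B r vB].
  exact: (hX (B, r)).
apply: closed_bigI => -[B r] _ /=.
have := @preimage_closed _ _ (fun X => complex.Re (\tr (B *m X))) [set x | r <= x].
apply; last exact: closed_ge.
by move=> X _; exact: Re_trace_continuous.
Qed.

Lemma orbit_hull_box p X i j : @orbit_hull p X ->
  `|complex.Re (X i j)| <= 1 /\ `|complex.Im (X i j)| <= 1.
Proof.
have tr_delta (c : C) (Y : 'M[C]_(udim p)) : \tr (c *: delta_mx j i *m Y) = c * Y i j.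
  rewrite -scalemxAl linearZ /=; congr (_ * _).
  rewrite /mxtrace (bigD1 j) //= big1 ?addr0 => [|k /negPf kj].
    rewrite mxE (bigD1 i) //= big1 ?addr0 => [|l /negPf li].
      by rewrite mxE !eqxx mul1r.
    by rewrite mxE li andbF mul0r.
  by rewrite mxE big1// => l _; rewrite mxE kj mul0r.
move=> hX; have b (c : C) : (forall v, v \is unitarymx -> -1 <= complex.Re (c * p v i
  j)) ->
    -1 <= complex.Re (c * X i j).
  move=> h; rewrite -tr_delta; apply: hX => v uv; rewrite tr_delta; exact: h.
have u v : v \is unitarymx -> `|complex.Re (p v i j)| <= 1 /\ `|complex.Im (p v i j)|
  <= 1.
  by move=> uv; exact/unitary_entry/uact_unitary.
have Re1 (z : C) : complex.Re (1 * z) = complex.Re z by rewrite mul1r.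
have ReN1 (z : C) : complex.Re ((-1 : C) * z) = - complex.Re z by case: z => ? ?;
  rewrite mulN1r.
have Rei (z : C) : complex.Re ('i * z) = - complex.Im z by case: z => ? ?; simpc.
have ReNi (z : C) : complex.Re (- 'i * z) = complex.Im z by case: z => ? ?; simpc.
split; rewrite ler_norml; apply/andP; split.
- by rewrite -Re1; apply: b => v /u[+ _]; rewrite Re1 ler_norml => /andP[].
- by rewrite -lerN2 -ReN1; apply: b => v /u[+ _];
  rewrite ReN1 lerN2 ler_norml => /andP[].
- by rewrite -ReNi; apply: b => v /u[_ +]; rewrite ReNi ler_norml => /andP[].
- by rewrite -lerN2 -Rei; apply: b => v /u[_ +]; rewrite Rei lerN2 ler_norml => /andP[].
Qed.

Lemma orbit_hull_invariant p g X : g \is unitarymx ->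
  @orbit_hull p X -> orbit_hull (p g *m X).
Proof.
move=> gu hX B r h; rewrite mulmxA; apply: hX => v uv.
by rewrite -mulmxA -uactM//; apply: h; rewrite mul_unitarymx.
Qed.

(** [T] plays the role of the integral of [p] for the Haar measure.  It is
    the element of least norm of the closed convex hull of [p]: translates of
    [T] have the same norm, and the midpoint of two distinct elements of least
    norm would be shorter. *)
Lemma invariant_mean (p : unitary_rep C n) : exists T : 'M[C]_(udim p),
  (forall g, g \is unitarymx -> p g *m T = T) /\
  forall B r, (forall v, v \is unitarymx -> r <= complex.Re (\tr (B *m p v))) ->
    r <= complex.Re (\tr (B *m T)).
Proof.
have K0 : @orbit_hull p !=set0 by exists (p 1%:M) => B r; apply; exact: unitarymx1.
have Kc : compact (@orbit_hull p).
  apply: (subclosed_compact _ (@mx_box_compact (udim p) (udim p) 1));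
    first exact: orbit_hull_closed.
  by move=> X hX i j; exact: orbit_hull_box.
have [T] := compact_EVT_min K0 Kc (continuous_subspaceT (@hs_norm2_continuous _ _)).
rewrite inE => hT Tmin; exists T; split=> // g gu.
have hgT := orbit_hull_invariant gu hT.
pose M := 2^-1 *: (p g *m T + T).
have hM : orbit_hull M.
  move=> B r h; have := hT B r h; have := hgT B r h.
  have -> : \tr (B *m M) = (2^-1%:C)%C * (\tr (B *m (p g *m T)) + \tr (B *m T)).
    by rewrite /M -scalemxAr linearZ mulmxDr linearD /= fmorphV rmorph_nat.
  move: (\tr _) (\tr _) => [a a'] [b b'] /=; simpc; lra.
have := Tmin M; rewrite inE => /(_ hM) MT.
have par (X Y : 'M[C]_(udim p)) :
    4 * hs_norm2 (2^-1 *: (X + Y)) + hs_norm2 (X - Y) = 2 * hs_norm2 X + 2 * hs_norm2 Y.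
  rewrite /hs_norm2 !mulr_sumr -!big_split; apply: eq_bigr => i _ /=.
  rewrite !mulr_sumr -!big_split; apply: eq_bigr => j _ /=.
  rewrite !mxE; have -> : 2^-1 = (2^-1%:C)%C :> C by rewrite fmorphV rmorph_nat.
  by move: (X i j) (Y i j) => [a a'] [b b'] /=; simpc; field.
apply/eqP; rewrite -subr_eq0; apply/eqP/hs_norm2_eq0.
have := par (p g *m T) T; rewrite -/M hs_norm2_unitary ?uact_unitary//; lra.
Qed.

End InvariantMean.


Section Nets.
Context {R : realType}.
Local Notation C := (complex_complex__canonical__Num_ClosedField R).

Lemma hs_norm2_triangle d e (X Y Z : 'M[C]_(d, e)) :
  hs_norm2 (X - Z) <= 2 * hs_norm2 (X - Y) + 2 * hs_norm2 (Z - Y).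
Proof.
rewrite /hs_norm2 !mulr_sumr -big_split; apply: ler_sum => i _ /=.
rewrite !mulr_sumr -big_split; apply: ler_sum => j _ /=.
rewrite !mxE; move: (X i j) (Y i j) (Z i j) => [a a'] [b b'] [c c'] /=.
rewrite -subr_ge0.
have -> : 2 * ((a - b) ^+ 2 + (a' - b') ^+ 2) + 2 * ((c - b) ^+ 2 + (c' - b') ^+ 2) -
  ((a - c) ^+ 2 + (a' - c') ^+ 2) = (a + c - 2 * b) ^+ 2 + (a' + c' - 2 * b') ^+ 2 by
    ring.
by rewrite addr_ge0 ?sqr_ge0.
Qed.

Lemma hs_norm2_1 d : hs_norm2 (1%:M : 'M[C]_d) = d%:R.
Proof.
apply: complexI; rewrite hs_norm2E trmx1 (map_mx1 Num.conj) mulmx1 mxtrace1.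
by rewrite rmorph_nat.
Qed.

(** Finitely many left translates of a neighbourhood of the identity cover
    [U(n)].  The centres of balls covering a compact box need not be unitary,
    so a unitary matrix is picked in each ball that contains one. *)
Lemma unitary_net n (e : R) : 0 < e -> exists N (w : 'I_N -> 'M[C]_n),
  (forall j, w j \is unitarymx) /\
  forall v, v \is unitarymx -> exists j, hs_norm2 (w j *m v - 1%:M) < e.
Proof.
move=> e0; pose B := [set X : 'M[C]_n | forall i j, square_box 1 (X i j)].
pose O (Y : 'M[C]_n) := [set X : 'M[C]_n | hs_norm2 (X - Y) < e / 4].
have Oo Y : open (O Y).
  have := @open_comp _ _ (fun X : 'M[C]_n => hs_norm2 (X - Y)) [set x | x < e / 4].
  apply; last exact: open_lt.
  move=> X _; apply: (@continuous_comp _ _ _ (fun X : 'M[C]_n => X - Y) (@hs_norm2 R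
    n n)).
    by apply: continuousB; [exact: cvg_id|exact: cst_continuous].
  exact: hs_norm2_continuous.
have : cover_compact B by rewrite -compact_cover; exact: mx_box_compact.
move=> /(_ _ setT O (fun Y _ => Oo Y)) [].
  move=> Y _; exists Y => //; rewrite /O /= subrr.
  suff -> : hs_norm2 (0 : 'M[C]_n) = 0 by rewrite divr_gt0.
  by rewrite /hs_norm2 big1// => i _; rewrite big1// => j _;
    rewrite mxE /= expr0n addr0.
move=> D _ BD; pose s : seq 'M[C]_n := finmap.enum_fset D.
pose u Y : 'M[C]_n := xget 1%:M [set v | v \is unitarymx /\ O Y v].
have uu Y : u Y \is unitarymx by rewrite /u; case: xgetP => [v _ []//|_];
  exact: unitarymx1.
exists (size s), (fun j => (u (nth 0 s j))^t*); split=> [j|v vu].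
  by rewrite trmxC_unitary.
have [|Y /= YD Yv] := BD v; first by move=> i j; exact: unitary_entry.
have jD : (index Y s < size s)%N by rewrite index_mem.
exists (Ordinal jD); rewrite /= nth_index//.
have -> : (u Y)^t* *m v - 1%:M = (u Y)^t* *m (v - u Y).
  by rewrite mulmxBr (unitarymx_conjtr (uu Y)).
rewrite hs_norm2_unitary; last by rewrite trmxC_unitary; exact: uu.
have : O Y (u Y) by rewrite /u; case: xgetP => [w _ []//|/(_ v)]; case.
rewrite /O /= in Yv *; have := hs_norm2_triangle v Y (u Y); lra.
Qed.

Lemma rep_near1 n (p : unitary_rep C n) (h : R) : 0 < h ->
  exists2 e : R, 0 < e & forall v, v \is unitarymx -> hs_norm2 (v - 1%:M) < e ->
    forall i j, `|(p v - 1%:M) i j| <= (h%:C)%C.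
Proof.
move=> h0; have hC : (0 : C) < (h%:C)%C by rewrite ltcR.
have : within [set u : 'M[C]_n | u \is unitarymx] (nbhs (1%:M : 'M[C]_n))
    [set v | ball (p 1%:M) (h%:C)%C (p v)].
  rewrite nbhs_subspace_in; last exact: unitarymx1.
  exact: (@uact_continuous _ _ p 1%:M _ (nbhsx_ballx (p 1%:M) _ hC)).
move=> /nbhs_ballP[_ /complex_gt0[e e0 ->] eP].
exists (e ^+ 2) => [|v vu ve i j]; first by rewrite exprn_gt0.
have : ball (p 1%:M) (h%:C)%C (p v).
  apply: eP => //; split=> [|k l]; first by rewrite ltcR.
  have e0C : (0 : C) <= (e%:C)%C by rewrite lecR ltW.
  rewrite /ball /= distrC -ltr_sqr ?nnegrE ?normr_ge0//.
  have := le_lt_trans (hs_norm2_entry (v - 1%:M) k l) ve.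
  by rewrite -ltcR add_Re2_Im2 rmorphXn !mxE.
by move=> [_ /(_ i j)]; rewrite /ball /= uact1 !mxE distrC => /ltW.
Qed.

Lemma hs_norm2_dotc d (x : 'cV[C]_d) : (hs_norm2 x)%:C%C = dotc x x.
Proof. by rewrite hs_norm2E mxtrace_mulC trace_mx11 dotcE. Qed.

Lemma dotc_bound d (A : 'M[C]_d) (h : R) (x : 'cV[C]_d) :
  (forall i j, `|A i j| <= (h%:C)%C) ->
  `|complex.Re (dotc (A *m x) x)| <= h * d%:R * hs_norm2 x.
Proof.
move=> Ah; rewrite -lecR; apply: le_trans (normc_ge_Re _) _.
have -> : (h * d%:R * hs_norm2 x)%:C%C =
    \sum_i \sum_j (h%:C)%C * ((`|x i ord0| ^+ 2 + `|x j ord0| ^+ 2) / 2) :> C.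
  pose s : C := \sum_i `|x i ord0| ^+ 2.
  have -> : (h * d%:R * hs_norm2 x)%:C%C = (h%:C)%C * d%:R * s.
    rewrite !rmorphM /= rmorph_nat; congr (_ * _).
    by rewrite hs_norm2_dotc; apply: eq_bigr => i _; rewrite normCK.
  rewrite (eq_bigr (fun i => (h%:C)%C / 2 * (d%:R * `|x i ord0| ^+ 2 + s))) => [|i
    _]; last first.
    rewrite -mulr_sumr -mulr_suml big_split /= sumr_const card_ord -/s -[_ *+
      d]mulr_natl.
    by rewrite mulrA mulrAC.
  rewrite -mulr_sumr big_split /= -mulr_sumr sumr_const card_ord -/s -[s *+ d]mulr_natl.
  by field.
apply: le_trans (ler_norm_sum _ _ _) _; apply: ler_sum => i _.
rewrite mxE mulr_suml; apply: le_trans (ler_norm_sum _ _ _) _; apply: ler_sum => j _.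
rewrite !normrM norm_conjC -mulrA ler_pM// ?mulr_ge0//.
rewrite ler_pdivlMr ?ltr0n//.
rewrite -subr_ge0; have -> : `|x i ord0| ^+ 2 + `|x j ord0| ^+ 2 -
  `|x j ord0| * `|x i ord0| * 2 = (`|x i ord0| - `|x j ord0|) ^+ 2 by ring.
by rewrite -realEsqr rpredB ?normr_real.
Qed.

Lemma geometric_beat (M a b : R) : 0 <= a -> a < b -> exists k, M * a ^+ k < b ^+ k.
Proof.
move=> a0 ab; have b0 : 0 < b by exact: le_lt_trans ab.
have ab0 : 0 <= a / b by rewrite divr_ge0// ltW.
have ab1 : `|a / b| < 1 by rewrite ger0_norm// ltr_pdivrMr// mul1r.
have M0 : 0 < (`|M| + 1)^-1 by rewrite invr_gt0 ltr_wpDl.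
have /cvgrPdist_lt /(_ _ M0)[k _ /(_ k (leqnn k))] := cvg_expr ab1.
rewrite sub0r normrN ger0_norm ?exprn_ge0//.
rewrite expr_div_n ltr_pdivrMr ?exprn_gt0// ltr_pdivlMl ?ltr_wpDl// => Mk.
exists k; apply: le_lt_trans Mk; rewrite ler_wpM2r ?exprn_ge0//.
by apply: le_trans (ler_norm M) _; rewrite lerDl.
Qed.

End Nets.


(** * Algebraicity of the continuous representations *)

Section TensBy.
Context {C : numClosedFieldType}.

Lemma regular_trace n d (P : 'M[C]_n -> 'M[C]_d) : regular_mx P ->
  regular (fun t => \tr (P t)).
Proof. by move=> rP; apply: regular_sum => i; exact: rP. Qed.

Lemma regular_conj_mx n d e (P : 'M[C]_n -> 'M[C]_(d, e)) : regular_mx P ->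
  exists2 P' : 'M[C]_n -> 'M[C]_(e, d), regular_mx P' &
    forall u, u \is unitarymx -> P' u = (P u)^t*.
Proof.
move=> rP; have /choice[G GP] (ij : 'I_e * 'I_d) : exists G : 'M[C]_n -> C, regular G /\
    forall u, u \is unitarymx -> G u = (P u ij.2 ij.1)^*.
  by have [G rG GE] := regular_conj (rP ij.2 ij.1); exists G.
exists (fun u => \matrix_(i, j) G (i, j) u) => [i j|u uu].
  by apply: regular_ext (GP (i, j)).1 => t; rewrite mxE.
by apply/matrixP => i j; rewrite !mxE (GP (i, j)).2.
Qed.

(** The operator [x |-> a (x) x]. *)
Definition tens_by m d (a : 'cV[C]_m) : 'M[C]_(m * d, d) :=
  \matrix_(k, j) (a (mxtens_unindex k).1 ord0 * ((mxtens_unindex k).2 == j)%:R).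

Lemma tens_byM m d (A : 'M[C]_m) (B : 'M[C]_d) (a : 'cV[C]_m) :
  tensmx A B *m tens_by d a = tens_by d (A *m a) *m B.
Proof.
apply/matrixP => k j; rewrite !mxE.
transitivity ((A *m a) (mxtens_unindex k).1 ord0 * B (mxtens_unindex k).2 j).
  transitivity ((\sum_l A (mxtens_unindex k).1 l * a l ord0) *
      (\sum_l B (mxtens_unindex k).2 l * (l == j)%:R)).
    by rewrite mulr_sum; apply: eq_bigr => l _; rewrite !mxE mulrACA.
  rewrite mxE; congr (_ * _);
    rewrite (bigD1 j) //= eqxx mulr1 big1 ?addr0// => l /negPf lj.
  by rewrite lj mulr0.
rewrite (bigD1 (mxtens_unindex k).2) //= [tens_by _ _ _ _]mxE eqxx mulr1 big1
  ?addr0// => l /negPf lk.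
by rewrite [tens_by _ _ _ _]mxE eq_sym lk mulr0 mul0r.
Qed.

Lemma tens_by_dot m d (a b : 'cV[C]_m) :
  (tens_by d b)^t* *m tens_by d a = (dotc a b)%:M.
Proof.
apply/matrixP => i j; rewrite !mxE.
transitivity ((\sum_k a k ord0 * (b k ord0)^*) * (\sum_l (l == i)%:R * (l == j)%:R)).
  rewrite mulr_sum; apply: eq_bigr => k _; rewrite !mxE rmorphM /= conjC_nat.
  by rewrite mulrACA [(b _ _)^* * _]mulrC.
rewrite [X in _ * X](bigD1 i) //= eqxx mul1r [X in _ + X]big1 ?addr0 ?mulr_natr// =>
  l /negPf li.
by rewrite li mul0r.
Qed.

Lemma regular_tens_by n m d (a : 'M[C]_n -> 'cV[C]_m) : regular_mx a ->
  regular_mx (fun u => tens_by d (a u)).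
Proof.
move=> ra k j; apply: regular_ext (regularM (ra (mxtens_unindex k).1 ord0)
  (regular_cst ((mxtens_unindex k).2 == j)%:R)) => t.
by rewrite mxE.
Qed.

End TensBy.

Section Peak.
Context {R : realType}.
Local Notation C := (complex_complex__canonical__Num_ClosedField R).
Context {n : nat}.

(** The squared distance of two unitary matrices is at most [4 n], so this
    factor keeps [real_peak] nonnegative. *)
Definition peak_cst : R := (4 * n%:R + 1)^-1.

(** On [U(n)] this is [1 - peak_cst * |t - 1|^2]: [cramer_inv t] is then the
    adjoint of [t]. *)
Definition peak (t : 'M[C]_n) : C :=
  1 - (peak_cst%:C)%C * \tr ((t - 1%:M) *m (cramer_inv t - 1%:M)).

Lemma regular_peak : regular peak.
Proof.
apply: regularB; first exact: regular_cst.
apply: regularM; first exact: regular_cst.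
apply: regular_trace; apply: regular_mulmx => i j.
  by apply: regular_ext (regularB (regular_entry i j) (regular_cst (i == j)%:R)) =>
    t; rewrite !mxE.
by apply: regular_ext (regularB (regular_mx_inv i j) (regular_cst (i == j)%:R)) => t;
  rewrite !mxE.
Qed.

Definition real_peak (v : 'M[C]_n) : R := 1 - peak_cst * hs_norm2 (v - 1%:M).

Lemma peakE v : v \is unitarymx -> peak v = (real_peak v)%:C%C.
Proof.
move=> vu; rewrite /peak cramer_invE; last exact: unitarymx_unit.
rewrite invmx_unitary; last exact: vu.
have -> : v^t* - 1%:M = (v - 1%:M)^t*.
  by apply/matrixP => i j; rewrite !mxE rmorphB /= conjC_nat eq_sym.
by rewrite -hs_norm2E -(rmorphM (real_complex R)) -(rmorph1 (real_complex R))
  -(rmorphB (real_complex R)).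
Qed.

Lemma peak_cst_gt0 : 0 < peak_cst.
Proof. by rewrite invr_gt0 ltr_wpDl// mulr_ge0. Qed.

Lemma real_peak_ge0 v : v \is unitarymx -> 0 <= real_peak v.
Proof.
move=> vu; rewrite subr_ge0 /peak_cst mulrC ler_pdivrMr;
  last by rewrite ltr_wpDl// mulr_ge0.
have := hs_norm2_triangle v 0 1%:M; rewrite !subr0 hs_norm2_1.
have -> : hs_norm2 v = n%:R by rewrite -[v]mulmx1 hs_norm2_unitary// hs_norm2_1.
lra.
Qed.

End Peak.

Section Algebraicity.
Context {R : realType}.
Local Notation C := (complex_complex__canonical__Num_ClosedField R).
Context {n : nat} (p : unitary_rep C n).

Local Notation d := (udim p).

(** The translates [w j] of the [k]-th power of the peak, times the positive
    part of [p] near the identity, outweigh what the far part of [p] can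
    contribute.  The sum over [j] makes the bound uniform in [v]: some [w j]
    always brings [v] close to the identity.  As the average of [p] is
    invariant, this bounds from below the form of the averaged operator. *)
Lemma peak_lower_bound : exists (N : nat) (w : 'I_N -> 'M[C]_n) (k : nat) (r : R),
  [/\ 0 < r, forall j, w j \is unitarymx &
  forall v (x : 'cV[C]_d), v \is unitarymx ->
    r * hs_norm2 x <= \sum_j real_peak (w j *m v) ^+ k *
      complex.Re (dotc (p (w j *m v) *m x) x)].
Proof.
have h0 : 0 < (2 * (d%:R + 1))^-1 :> R by rewrite invr_gt0 mulr_gt0// ltr_wpDl.
have [e' e'0 near1'] := rep_near1 p h0.
(* the bound by 1 makes [a] below nonnegative *)
pose e := Num.min e' 1.
have e0 : 0 < e by rewrite lt_min e'0 ltr01.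
have near1 v (x : 'cV[C]_d) : v \is unitarymx -> hs_norm2 (v - 1%:M) < e ->
    hs_norm2 x / 2 <= complex.Re (dotc (p v *m x) x).
  move=> vu; rewrite lt_min => /andP[ve _].
  have -> : complex.Re (dotc (p v *m x) x) =
      hs_norm2 x + complex.Re (dotc ((p v - 1%:M) *m x) x).
    rewrite mulmxBl mul1mx.
    have -> : dotc (p v *m x - x) x = dotc (p v *m x) x - dotc x x.
      by rewrite /dotc -sumrB; apply: eq_bigr => i _; rewrite !mxE mulrBl.
    rewrite -hs_norm2_dotc; case: (dotc _ _) => a b /=; ring.
  have := dotc_bound x (near1' v vu ve); rewrite ler_norml => /andP[+ _].
  have : (2 * (d%:R + 1))^-1 * d%:R * hs_norm2 x <= hs_norm2 x / 2.
    rewrite [leRHS]mulrC ler_wpM2r ?hs_norm2_ge0// invfM -mulrA ger_pMr ?invr_gt0//.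
    by rewrite mulrC ler_pdivrMr ?ltr_wpDl// mul1r lerDl.
  lra.
have far v (x : 'cV[C]_d) : v \is unitarymx ->
    - (d%:R * hs_norm2 x) <= complex.Re (dotc (p v *m x) x).
  move=> vu; have p1 i j : `|p v i j| <= (1%:C)%C.
    by apply: unitary_entry_le1; exact: uact_unitary.
  by have := dotc_bound x p1; rewrite mul1r ler_norml => /andP[].
have [N [w [wu wn]]] := unitary_net n (divr_gt0 e0 (ltr0n R 2)).
have c0 : 0 < peak_cst :> R := @peak_cst_gt0 R n.
(* [a] bounds the peak far from the identity, [b] its value at the net points *)
pose a : R := 1 - @peak_cst R n * e; pose b : R := 1 - @peak_cst R n * (e / 2).
have ab : a < b.
  by rewrite ltrD2l ltrN2 ltr_pM2l// ltr_pdivrMr// ltr_pMr// ltr1n.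
have c1 : @peak_cst R n <= 1 by rewrite invf_le1 ?ltr_wpDl ?mulr_ge0// lerDr mulr_ge0.
have a0 : 0 <= a.
  have e1 : e <= 1 by rewrite ge_min lexx orbT.
  by rewrite subr_ge0; apply: mulr_ile1 => //; exact: ltW.
have b0 : 0 < b := le_lt_trans a0 ab.
have [k Mk] := geometric_beat (2 * (N%:R * d%:R)) a0 ab.
exists N, w, k, (b ^+ k / 2 - N%:R * d%:R * a ^+ k); split=> //; first lra.
move=> v x vu; have [j wj] := wn v vu.
have wvu i := mul_unitarymx (wu i) vu.
have x0 := hs_norm2_ge0 x.
have term i : - (a ^+ k * (d%:R * hs_norm2 x)) <= real_peak (w i *m v) ^+ k *
    complex.Re (dotc (p (w i *m v) *m x) x).
  have q0 := real_peak_ge0 (wvu i).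
  have [we|we] := ltP (hs_norm2 (w i *m v - 1%:M)) e.
    apply: (@le_trans _ _ 0); first by rewrite oppr_le0 !mulr_ge0// exprn_ge0.
    rewrite mulr_ge0 ?exprn_ge0//; apply: le_trans (near1 _ _ (wvu i) we).
    by rewrite divr_ge0.
  apply: (@le_trans _ _ (real_peak (w i *m v) ^+ k * - (d%:R * hs_norm2 x))).
    rewrite mulrN lerN2 ler_wpM2r ?mulr_ge0// lerXn2r ?nnegrE//.
    by rewrite /real_peak /a lerD2l lerN2 ler_pM2l.
  by apply: ler_wpM2l; [exact: exprn_ge0|exact: far (wvu i)].
have special : b ^+ k * (hs_norm2 x / 2) <= real_peak (w j *m v) ^+ k *
    complex.Re (dotc (p (w j *m v) *m x) x).
  have we : hs_norm2 (w j *m v - 1%:M) < e.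
    by apply: lt_trans wj _; rewrite ltr_pdivrMr// ltr_pMr// ltr1n.
  apply: ler_pM; [exact/exprn_ge0/ltW|exact: divr_ge0| |exact: near1 (wvu j) we].
  apply: lerXn2r; [exact: ltW|exact: real_peak_ge0 (wvu j)|apply: ltW].
  by rewrite /real_peak /b ltrD2l ltrN2 ltr_pM2l.
rewrite (bigD1 j) //=.
have rest : - (N%:R * d%:R * a ^+ k * hs_norm2 x) <= \sum_(i | i != j)
    real_peak (w i *m v) ^+ k * complex.Re (dotc (p (w i *m v) *m x) x).
  apply: (@le_trans _ _ (\sum_(i < N | i != j) - (a ^+ k * (d%:R * hs_norm2 x))));
    last first.
    by apply: ler_sum => i _; exact: term.
  apply: (@le_trans _ _ (\sum_(i < N) - (a ^+ k * (d%:R * hs_norm2 x)))).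
    by rewrite sumr_const card_ord -mulr_natl; lra.
  rewrite [leLHS](bigD1 j) //= gerDr oppr_le0 !mulr_ge0// exprn_ge0//.
lra.
Qed.

(** Let [T] be the invariant mean of [Q (x) p], where [Q] has regular entries
    and a coefficient [q] equal to a power of the peak, and let [S T] be the
    corresponding mean of [q p].  Invariance of [T] trades the factor [p u]
    in front of [S T] for coefficients of the adjoint of [Q u], which are
    regular.  The real part of the form of [S T] is positive definite by
    [peak_lower_bound], so [S T] can be divided out. *)
Theorem rep_regular : exists2 P : 'M[C]_n -> 'M[C]_d, regular_mx P &
  forall u, u \is unitarymx -> P u = p u.
Proof.
have [N [w [k [r [r0 wu lower]]]]] := peak_lower_bound.
have [Q [a [b [rQ qE]]]] := regular_matrix_coef (regularX k (@regular_peak R n)).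
have [T [Tinv Thull]] := invariant_mean (tens_rep Q p).
pose S X : 'M[C]_d := (tens_by d b)^t* *m X *m tens_by d a.
have S_rep v : v \is unitarymx -> S (tens_rep Q p v) = ((real_peak v)%:C ^+ k)%C *: p v.
  move=> vu; rewrite /S -mulmxA tens_byM mulmxA tens_by_dot mul_scalar_mx.
  by rewrite -(qE v vu) (peakE vu).
have S_inj : S T \in unitmx.
  rewrite unitmxE unitfE; apply/negP => /det0P[y y0 yS].
  pose x := y^t*.
  (* [B X] is the form of [S X] at [x], and [Bsum] sums its translates *)
  pose B X := \tr (tens_by d a *m x *m x^t* *m (tens_by d b)^t* *m X).
  have BE X : B X = dotc (S X *m x) x.
    rewrite dotcE -trace_mx11 /B /S -!mulmxA mxtrace_mulC.
    by rewrite -!mulmxA mxtrace_mulC -!mulmxA.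
  have xT : dotc (S T *m x) x = 0.
    by rewrite dotcE /x trmxCK mulmxA yS mul0mx mxE.
  pose Bsum := \sum_j
    tens_by d a *m x *m x^t* *m (tens_by d b)^t* *m tens_rep Q p (w j).
  have BsumE X : \tr (Bsum *m X) = \sum_j B (tens_rep Q p (w j) *m X).
    rewrite /Bsum mulmx_suml raddf_sum; apply: eq_bigr => j _.
    by rewrite /B !mulmxA.
  have Re_sum (I : finType) (f : I -> C) : complex.Re (\sum_i f i) = \sum_i
    complex.Re (f i).
    by apply: (big_morph _ (id1 := 0)) => // -[? ?] [? ?].
  have := Thull Bsum (r * hs_norm2 x); apply/not_implyP; split.
    move=> v vu; rewrite BsumE Re_sum; apply: le_trans (lower v x vu) _.
    apply: ler_sum => j _; have wv := mul_unitarymx (wu j) vu.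
    rewrite -(uactM (tens_rep Q p) (wu j) vu) BE (S_rep _ wv).
    rewrite -scalemxAl.
    have -> (c : C) (z : 'cV[C]_d) : dotc (c *: z) x = c * dotc z x.
      by rewrite /dotc mulr_sumr; apply: eq_bigr => i _; rewrite mxE mulrA.
    by rewrite -rmorphXn; case: (dotc _ _) => ? ? /=; rewrite mul0r subr0.
  apply/negP; rewrite -ltNge BsumE big1 => [|j _]; last by rewrite Tinv// BE xT.
  rewrite pmulr_rgt0//= lt_neqAle hs_norm2_ge0 andbT eq_sym.
  apply: contra y0 => /eqP x0; rewrite -[y]trmxCK -/x.
  by rewrite (hs_norm2_eq0 (_ : hs_norm2 x <= 0)) ?x0// trmx0 map_mx0.
(* [tens_by d b *m (p u)^t*] is [tens_by d b] followed by [1 (x) p(u)^*], that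
   is, by [(Q (x) p)(u)^* (Q(u) (x) 1)]; the adjoint of the first factor fixes [T] *)
have pS u : u \is unitarymx ->
    p u *m S T = (tens_by d (Q u *m b))^t* *m T *m tens_by d a.
  move=> uu; have Pu := uact_unitary (tens_rep Q p) uu; have pu := uact_unitary p uu.
  have bp : tens_by d b *m (p u)^t* = (tens_rep Q p u)^t* *m tens_by d (Q u *m b).
    rewrite -[LHS]mul1mx -(unitarymx_conjtr Pu) -mulmxA; congr (_ *m _).
    by rewrite mulmxA tens_byM -mulmxA (unitarymxP pu) mulmx1.
  rewrite /S !mulmxA -{1}[p u]trmxCK -conjtr_mul bp conjtr_mul trmxCK.
  by rewrite -[_ *m T]mulmxA Tinv.
have rQb : regular_mx (fun u => tens_by d (Q u *m b)).
  by apply: regular_tens_by; apply: regular_mulmx => //; exact: regular_mx_cst.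
have [P' rP' P'E] := regular_conj_mx rQb.
exists (fun u => P' u *m (T *m tens_by d a *m invmx (S T))) => [|u uu].
  by apply: regular_mulmx => //; exact: regular_mx_cst.
by rewrite P'E// !mulmxA -pS// mulmxK.
Qed.

End Algebraicity.


(** * Evaluation functionals *)

Section PositiveMatrices.
Context {C : numClosedFieldType}.

Lemma dotc_delta d (A : 'M[C]_d) i j :
  dotc (A *m (delta_mx j ord0 : 'cV_d)) (delta_mx i ord0) = A i j.
Proof.
rewrite /dotc (bigD1 i) //= big1 ?addr0 => [|k /negPf ki].
  by rewrite -colE !mxE !eqxx conjC1 mulr1.
by rewrite [delta_mx i _ _ _]mxE ki conjC0 mulr0.
Qed.

Lemma dotc_adjoint d (A : 'M[C]_d) (x y : 'cV[C]_d) :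
  dotc (A *m x) y = dotc x (A^t* *m y).
Proof.
by rewrite !dotcE conjtr_mul trmxCK mulmxA.
Qed.

Lemma psdmx_gram d (M : 'M[C]_d) : psdmx (M *m M^t*).
Proof.
split; first by apply/is_hermitianmxP; rewrite expr0 scale1r conjtr_mul trmxCK.
move=> x; rewrite -mulmxA dotc_adjoint; apply: sumr_ge0 => i _.
exact: mul_conjC_ge0.
Qed.

Lemma psdmx_factor d (t : 'M[C]_d) : psdmx t -> exists s : 'M[C]_d, t = s *m s^t*.
Proof.
move=> [th tp]; have /orthomx_spectralP := hermitian_normalmx th.
set v := spectralmx t; set l := spectral_diag t => tE.
have vu : v \is unitarymx by exact: spectral_unitarymx.
rewrite invmx_unitary// in tE.
have lE : v *m t *m v^t* = diag_mx l.
  rewrite tE !mulmxA (unitarymxP vu) mul1mx -mulmxA.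
  by rewrite (unitarymxP vu) mulmx1.
have l0 j : 0 <= l 0 j.
  have -> : l 0 j = (v *m t *m v^t*) j j by rewrite lE mxE eqxx mulr1n.
  by rewrite -dotc_delta -!mulmxA dotc_adjoint.
pose r : 'rV[C]_d := \row_j sqrtC (l 0 j).
have r0 j : 0 <= r 0 j by rewrite mxE sqrtC_ge0.
exists (v^t* *m diag_mx r).
rewrite conjtr_mul trmxCK conjtr_diag// -mulmxA (mulmxA _ _ v).
rewrite mulmx_diag [LHS]tE mulmxA; congr (_ *m diag_mx _ *m _).
by apply/rowP => j; rewrite !mxE -expr2 sqrtCK.
Qed.

End PositiveMatrices.

Section Evaluation.
Context {R : realType} {n : nat}.
Local Notation C := (complex_complex__canonical__Num_ClosedField R).
Local Notation U := (unitary_group C n).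
Local Notation G := (general_linear C n).
Local Notation A := (coef_alg C n).

Lemma regular_rep_mul (p : unitary_rep C n) P : regular_mx P ->
  (forall u, u \is unitarymx -> P u = p u) ->
  forall s t, s \in unitmx -> t \in unitmx -> P (s *m t) = P s *m P t.
Proof.
move=> rP PE; apply: (regular_mx_mul rP) => u v uu uv.
by rewrite (PE _ uu) (PE _ uv) (PE _ (mul_unitarymx uu uv)) (uactM p uu uv).
Qed.

(** Existence in the unitary trick: regular functions are holomorphic on
    [GL(n, C)], and multiplicativity is inherited from [U(n)] by density. *)
Lemma regular_rep_holomorphic (p : unitary_rep C n) P : regular_mx P ->
  (forall u, u \is unitarymx -> P u = p u) -> @holomorphic_ext C n p P.
Proof.
move=> rP PE; split=> [||t|]; last exact: PE.
- by rewrite (PE _ (unitarymx1 _ _)) uact1.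
- exact: regular_rep_mul PE.
- exact: regular_mx_differentiable.
Qed.

Lemma holomorphic_ext_regular (p : unitary_rep C n) P : @holomorphic_ext C n p P ->
  exists P', [/\ regular_mx P', forall u, u \is unitarymx -> P' u = p u
    & forall t, t \in unitmx -> P t = P' t].
Proof.
move=> [P1 PM dP PE]; have [P' rP' P'E] := rep_regular p; exists P'; split=> //.
have [P'1 P'M dP' _] := regular_rep_holomorphic rP' P'E.
apply: (holomorphic_rep_unique (And3 P1 PM dP) (And3 P'1 P'M dP')) => u uu.
by rewrite (PE _ uu) (P'E _ uu).
Qed.

Lemma regular_dotc d (P : 'M[C]_n -> 'M[C]_d) xi eta : regular_mx P ->
  regular (fun t => dotc (P t *m xi) eta).
Proof.
move=> rP; apply: regular_sum => i; apply: regularM; last exact: regular_cst.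
by apply: regular_mulmx => //; exact: regular_mx_cst.
Qed.

(** This makes the extension independent of its presentation as a sum of
    coefficients: it is regular, hence determined by [f]. *)
Lemma GL_extension_regular (f : U -> C) (F0 : G -> C) : GL_extension (f, F0) ->
  exists F, [/\ regular F, forall u, F (val u) = f u & forall t, F (val t) = F0 t].
Proof.
move=> [k [a [g [gP]]]].
have /choice[F FP] i : exists F, [/\ regular F, forall u, F (val u) = (g i).1 u
    & forall t, F (val t) = (g i).2 t].
  have [p [P [xi [eta [/holomorphic_ext_regular[P' [rP' P'E PP']] ->]]]]] := gP i.
  exists (fun t => dotc (P' t *m xi) eta); split; first exact: regular_dotc.
    by move=> u; rewrite P'E//; exact: valP.
  by move=> t /=; rewrite /GL_coef PP'//; exact: valP.
move=> fE; exists (fun t => \sum_i a i * F i t); split.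
- apply: regular_sum => i; apply: regularM; first exact: regular_cst.
  by case: (FP i).
- move=> u; have -> : f = \sum_i a i *: (g i).1.
    by rewrite [LHS](congr1 fst fE); elim/big_rec2: _ => // i x y _ <-.
  by rewrite fct_sumE; apply: eq_bigr => i _; case: (FP i) => _ ->.
- move=> t; have -> : F0 = \sum_i a i *: (g i).2.
    by rewrite [LHS](congr1 snd fE); elim/big_rec2: _ => // i x y _ <-.
  by rewrite fct_sumE; apply: eq_bigr => i _; case: (FP i) => _ _ ->.
Qed.

Lemma GL_extension_exists (f : A) : exists F0, GL_extension (f : U -> C, F0).
Proof.
have /asboolP[k [a [g [gP fE]]]] := valP f.
have /choice[F FP] i : exists F : G -> C, GL_extension (g i, F).
  have [p [xi [eta ->]]] := gP i; have [P rP PE] := rep_regular p.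
  have hP := regular_rep_holomorphic rP PE.
  by exists (GL_coef P xi eta); apply: lin_span_gen; exists p, P, xi, eta.
exists (\sum_i a i *: F i).
have -> : ((f : U -> C), \sum_i a i *: F i) = \sum_i a i *: (g i, F i).
  rewrite [X in (X, _)](fE : coef_fun f = _).
  by elim: (index_enum _) => [|i s ih]; rewrite ?big_nil // !big_cons -ih.
by apply: lin_span_sum => i; apply: lin_spanZ; exact: FP.
Qed.

Lemma coef_alg_regular (f : A) : exists2 F, regular F & forall u, F (val u) = f u.
Proof.
by have [F0 /GL_extension_regular[F [rF FE _]]] := GL_extension_exists f; exists F.
Qed.

Lemma regular_coef_alg F : regular F -> exists f : A, forall u, F (val u) = f u.
Proof.
move=> /regular_matrix_coef[p [xi [eta [_ FE]]]]; exists (coef xi eta) => u.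
by rewrite FE//; exact: valP.
Qed.

Lemma extendE (f : A) F t : regular F -> (forall u, F (val u) = f u) ->
  extend f t = F (val t).
Proof.
move=> rF FE; rewrite /extend; case: xgetP => [F0 _ /GL_extension_regular|]; last first.
  by have [F0 fF0] := GL_extension_exists f => /(_ F0).
move=> [F' [rF' F'E <-]]; apply: (regular_eq rF' rF); last exact: valP.
by move=> u uu; rewrite (F'E (exist _ u uu)) (FE (exist _ u uu)).
Qed.

Definition extend_at (t : G) (f : A) : C := extend f t.

Lemma extend_at_scalar t : scalar (extend_at t).
Proof.
move=> a f g; have [F rF FE] := coef_alg_regular f;
  have [H rH HE] := coef_alg_regular g.
rewrite /extend_at (extendE _ rF FE) (extendE _ rH HE).
apply: (extendE t (F := fun t => a * F t + H t)).
  by apply: regularD => //; apply: regularM => //; exact: regular_cst.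
by move=> u; rewrite FE HE.
Qed.

HB.instance Definition _ t :=
  GRing.isLinear.Build C A C *%R (extend_at t) (extend_at_scalar t).

Lemma evaluationE (f : A) F t : regular F -> (forall u, F (val u) = f u) ->
  evaluation t f = F (val t).
Proof.
move=> rF FE; rewrite /evaluation; case: xgetP => [x _ /(_ f) ->|].
  exact: extendE.
by move=> /(_ (extend_at t : {scalar A})) [].
Qed.

Lemma evaluation_group_like (t : G) : @group_like C n (evaluation t).
Proof.
apply/group_likeP; split=> [e0|f g].
  have := @evaluationE 1 (fun=> 1) t (regular_cst 1) (fun=> erefl).
  by rewrite e0 => /eqP; rewrite eq_sym oner_eq0.
have [F rF FE] := coef_alg_regular f; have [H rH HE] := coef_alg_regular g.
rewrite (evaluationE t rF FE) (evaluationE t rH HE).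
apply: (evaluationE t (F := fun t => F t * H t)); first exact: regularM.
by move=> u; rewrite FE HE.
Qed.

Lemma evaluation_inj : injective (@evaluation C n).
Proof.
move=> s t st; apply/val_inj/matrixP => i j.
have [f fE] := regular_coef_alg (regular_entry i j).
have := evaluationE s (regular_entry i j) fE.
by rewrite st (evaluationE t (regular_entry i j) fE).
Qed.

(** A nonzero multiplicative functional is an algebra morphism, and it
    is determined by its values on the coordinate functions: these generate
    the coefficient algebra together with the inverse of the determinant. *)
Lemma group_like_evaluation x : @group_like C n x -> exists t : G, evaluation t = x.
Proof.
move=> /group_likeP[x0 xM].
have x1 : x 1 = 1.
  have [f xf] : exists f, x f != 0.
    apply: contra_notP x0 => xf; apply/funext => f /=; apply/eqP.
    by apply: contra_notT xf => xf; exists f.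
  by apply: (mulfI xf); rewrite -xM !mulr1.
have ext (f g : A) : (forall u, f u = g u) -> f = g by move=> fg; exact/val_inj/funext.
have /choice[e eE] (ij : 'I_n * 'I_n) : exists f : A, forall u : U, val u ij.1 ij.2 =
  f u.
  exact: (regular_coef_alg (regular_entry ij.1 ij.2)).
pose T : 'M[C]_n := \matrix_(i, j) x (e (i, j)).
pose D : A := \det (\matrix_(i, j) e (i, j)).
have DE (u : U) : \det (val u) = D u.
  rewrite /D /determinant coef_fun_sum; apply: eq_bigr => s _.
  have signE (b : bool) (h : A) : ((-1) ^+ b * h) u = (-1) ^+ b * h u.
    by case: b; rewrite ?mul1r// !mulN1r.
  rewrite [RHS]signE; congr (_ * _); elim/big_rec2: _ => // i y z _ ->.
  by rewrite mxE (eE (i, s i)).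
have xD : x D = \det T.
  rewrite /D /determinant linear_sum; apply: eq_bigr => s _.
  have signE (b : bool) (h : A) : x ((-1) ^+ b * h) = (-1) ^+ b * x h.
    by case: b; rewrite ?mul1r// !mulN1r linearN.
  rewrite signE; congr (_ * _); elim/big_rec2: _ => // i y z _ <-.
  by rewrite xM !mxE.
have [Dv DvE] := regular_coef_alg (@regular_detV C n).
have xDv : x Dv * \det T = 1.
  rewrite -xD -xM -x1; congr (x _); apply: ext => u.
  rewrite -[LHS]/(Dv u * D u) -DvE -DE mulVf//.
  by rewrite -unitfE -unitmxE unitarymx_unit//; exact: valP.
have Tu : T \in unitmx.
  by rewrite unitmxE unitfE; apply: contra_eq_neq xDv => ->;
    rewrite mulr0 eq_sym oner_eq0.
exists (exist _ T Tu); apply: dual_ext => f.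
have [F rF FE] := coef_alg_regular f; rewrite (evaluationE _ rF FE) /=.
elim: rF f FE => {F} [c|i j||F H rF ihF rH ihH|F H rF ihF rH ihH] f FE.
- have -> : f = c *: (1 : A) by apply: ext => u; rewrite -FE /= -[RHS]/(c * 1) mulr1.
  by rewrite linearZ /= x1 mulr1.
- have -> : f = e (i, j) by apply: ext => u; rewrite -FE (eE (i, j)).
  by rewrite mxE.
- have -> : f = Dv by apply: ext => u; rewrite -FE DvE.
  by apply: (mulIf (_ : \det T != 0)); rewrite ?mulVf// -?unitfE -?unitmxE.
- have [f' f'E] := regular_coef_alg rF; have [h hE] := regular_coef_alg rH.
  have -> : f = f' + h by apply: ext => u; rewrite -FE f'E hE.
  by rewrite linearD (ihF _ f'E) (ihH _ hE).
- have [f' f'E] := regular_coef_alg rF; have [h hE] := regular_coef_alg rH.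
  have -> : f = f' * h by apply: ext => u; rewrite -FE f'E hE.
  by rewrite xM (ihF _ f'E) (ihH _ hE).
Qed.

Lemma rep_dual_evaluation (p : unitary_rep C n) P t : regular_mx P ->
  (forall u, u \is unitarymx -> P u = p u) -> rep_dual p (evaluation t) = P (val t).
Proof.
move=> rP PE; apply/matrixP => i j; rewrite mxE.
apply: (evaluationE t (rP i j)) => u.
by rewrite /= /matrix_coef dotc_delta PE//; exact: valP.
Qed.

(** The standard representation recovers [t] from its evaluation.  In the
    other direction, a factorization [t = s s^*] is inherited by [P t], as
    [P] commutes with adjoints on [U(n)], hence everywhere by density. *)
Lemma evaluation_positive (t : G) : positive (evaluation t) <-> psdmx (val t).
Proof.
split=> [/(_ (std_rep (C := C) (n := n)))|tp p].
  by rewrite (@rep_dual_evaluation std_rep id t regular_mx_id).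
have [P rP PE] := rep_regular p; rewrite (rep_dual_evaluation t rP PE).
have [s ts] := psdmx_factor tp; have tu := valP t.
have /andP[su su'] : (s \in unitmx) && (s^t* \in unitmx) by rewrite -unitmx_mul -ts.
rewrite ts (regular_rep_mul rP PE su su').
rewrite (regular_mx_adjoint rP _ su); first exact: psdmx_gram.
move=> u uu; rewrite !PE ?trmxC_unitary//.
rewrite -[LHS]mulmx1 -(unitarymxP (uact_unitary p uu)) mulmxA -uactM ?trmxC_unitary//.
by rewrite unitarymx_conjtr// uact1 mul1mx.
Qed.

End Evaluation.

Local Open Scope complex_scope.

Theorem lemma6p1 (R : realType) (n : nat) (n_ge1 : (1 <= n)%N) :
  set_bij [set: general_linear R[i] n] (@group_like R[i] n)
    (@evaluation R[i] n) /\
  (forall t : general_linear R[i] n,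
     positive_group_like (evaluation t) <-> positive_GL t).
Proof.
split; last first.
  move=> t; rewrite /positive_GL /= -evaluation_positive; split=> [[]//|pt].
  by split=> //; exact: evaluation_group_like.
split=> [t _|s t _ _|x /group_like_evaluation[t <-]].
- exact: evaluation_group_like.
- exact: evaluation_inj.
- by exists t.
Qed.
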